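(* Let $d\ge 1$ be an integer. Let $\mu_1,\mu_2,\mu_3\in\mathbb{R}^d$ be arbitrary, and let $w_1,w_2,w_3\ge 0$ be arbitrary real weights satisfying $w_1+w_2+w_3=1$. Let $\varphi$ be the standard $d$-variate Gaussian density and let $$\overline{\varphi}(x)=\sum_{j=1}^{3} w_j\,\varphi(x-\mu_j),\qquad x\in\mathbb{R}^d.$$ Then $\overline{\varphi}$ has at most $8$ modes.
   Context: The standard $d$-variate Gaussian density is $\varphi(x)=(2\pi)^{-d/2}\exp(-\|x\|_2^2/2)$ for $x\in\mathbb{R}^d$. A mode of $\overline{\varphi}$ is a local maximizer of $\overline{\varphi}$, i.e. a point $x_0\in\mathbb{R}^d$ such that $\overline{\varphi}(x)\le\overline{\varphi}(x_0)$ for all $x$ in some neighborhood of $x_0$. If the set of modes is not finite, the number of modes is defined to be infinite; thus the claim includes the assertion that the set of modes is finite. *)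

(* Defs.v *)
From HB Require Import structures.
From mathcomp Require Export all_boot all_order all_algebra finmap.
From mathcomp Require Export all_classical all_reals all_analysis.
Export Order.TTheory GRing.Theory Num.Theory numFieldNormedType.Exports.

Set Implicit Arguments.
Unset Strict Implicit.
Unset Printing Implicit Defensive.

Local Open Scope classical_set_scope.
Local Open Scope ring_scope.

(* The Euclidean norm; the library norm `|x| on 'rV[R]_d is the sup norm. It
   induces the same topology, so neighborhoods in 'rV[R]_d are the usual ones *)
Definition norm2 (R : realType) (d : nat) (x : 'rV[R]_d) : R :=
  Num.sqrt (\sum_(i < d) x 0 i ^+ 2).

Definition gauss_density (R : realType) (d : nat) (x : 'rV[R]_d) : R :=
  (2 * pi) `^ (- (d%:R / 2)) * expR (- (norm2 x ^+ 2 / 2)).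

Definition gauss_mixture (R : realType) (d k : nat)
    (w : 'I_k -> R) (mu : 'I_k -> 'rV[R]_d) (x : 'rV[R]_d) : R :=
  \sum_(j < k) w j * gauss_density (x - mu j).

(* Maximality is non-strict: a flat maximum consists of modes *)
Definition modes (R : realType) (T : topologicalType) (f : T -> R) : set T :=
  [set x0 | \forall x \near x0, f x <= f x0].

(* Main.v *)
(* Put v = mu_1 - mu_0, g = mu_2 - mu_0, D = <v,v>, Q = <v,g>, M = <g,g>. If the
   means are collinear or a weight vanishes, the modes are zeros of an exponential
   polynomial with at most 6 coefficients, so there are at most 5 of them.
   Otherwise a critical point is x = mu_0 + a v + b g, where 1 - a - b, a, b are
   the posterior weights of the components. Put S = <x - mu_0, v> = D a + Q b. The
   posterior odds a / (1 - a - b) = e = k exp S depend on S only, so the equation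
   S = D a + Q b can be solved for b = nu S / rho S, and the remaining equation
   becomes logit S = ln l for one function logit of S.
   The derivative of logit is a positive multiple of
   hess S = D rho^3 det(I - Cov G), where G is the Gram matrix of v and g and Cov
   the covariance of the posterior. It is an exponential polynomial whose 14
   coefficients allow at most 13 zeros, by iterated Rolle. At a nondegenerate
   mode logit crosses its level in a prescribed direction, so two consecutive
   modes enclose two zeros of hess unless the condition 0 < b < 1 fails between
   them, which happens at most once. Hence 2 (m - 2) <= 13 for m modes.
   Degenerate modes, and the case rho Q = 0 in which S does not determine x, are
   removed by perturbing the weights: the modes form a finite set (one zero of
   hess per gap suffices for that), so they are strict maxima and persist. *)

Require Import Defs.
From mathcomp Require Import ring lra zify.

Set Implicit Arguments.
Unset Strict Implicit.
Unset Printing Implicit Defensive.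

Local Open Scope fset_scope.
Local Open Scope classical_set_scope.
Local Open Scope ring_scope.

(** * Zeros of exponential polynomials *)

Lemma mvt_cc (R : realType) (f df : R -> R) (a b : R) : a < b ->
  (forall x : R, a <= x <= b -> is_derive x 1 f (df x)) ->
  exists2 c, a < c < b & f b - f a = df c * (b - a).
Proof.
move=> ab fdf.
have [||c + fE] := @MVT R f df a b ab.
- by move=> x; rewrite in_itv /= => /andP[/ltW ax /ltW xb]; apply: fdf; rewrite ax.
- apply: derivable_within_continuous => x; rewrite in_itv /= => axb.
  by have [] := fdf x axb.
- by rewrite in_itv /= => acb; exists c.
Qed.

(** Induction on the list: every good gap between neighbours contributes [k] points. Once a bad gap
    occurs, its endpoints are carried along as a witness, so a second bad gap further left
    contradicts the last hypothesis and at most one gap is lost. *)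
Lemma sorted_subgaps (R : realType) (good : R -> R -> Prop) (Z : R -> Prop)
    (k : nat) (x : R) (l : seq R) :
  path <%R x l ->
  (forall a b, a \in x :: l -> b \in x :: l -> a < b -> good a b ->
    exists t : seq R, [/\ sorted <%R t, size t = k &
      forall c, c \in t -> a < c < b /\ Z c]) ->
  (forall a b c d, a \in x :: l -> b \in x :: l -> c \in x :: l ->
    d \in x :: l -> a < b -> b <= c -> c < d ->
    ~ good a b -> ~ good c d -> False) ->
  exists t : seq R, [/\ sorted <%R t, forall c, c \in t -> x < c /\ Z c &
    (k * size l <= size t)%N \/
    (exists a b, [/\ a \in x :: l, b \in x :: l, a < b & ~ good a b]) /\
    (k * (size l).-1 <= size t)%N].
Proof.
elim: l x => [x _ _ _|y l IH x /= /andP[xy yl] gaps bad].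
  by exists [::]; split=> //; left; rewrite muln0.
have sub a : a \in y :: l -> a \in x :: y :: l.
  by rewrite [a \in x :: _]in_cons => ->; rewrite orbT.
have [||t [st tZ tsz]] := IH y yl.
- by move=> a b /sub ? /sub ?; apply: gaps.
- by move=> a b c d /sub ? /sub ? /sub ? /sub ?; apply: bad.
have ymin a : a \in y :: l -> y <= a.
  rewrite in_cons => /predU1P[->//|al].
  by apply: ltW; move: yl; rewrite lt_path_sortedE => /andP[/allP/(_ _ al)].
have [gxy|ngxy] := pselect (good x y).
  have [||//|//|t0 [st0 sz0 t0Z]] := gaps x y; rewrite ?inE ?eqxx ?orbT //.
  exists (t0 ++ t); split.
  - move: st st0; rewrite !lt_sorted_pairwise pairwise_cat => -> -> /=.
    rewrite andbT.
    apply/allrelP => a b /t0Z[/andP[_ ay] _] /tZ[yb _].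
    exact: lt_trans yb.
  - move=> c; rewrite mem_cat => /orP[/t0Z[/andP[]//]|/tZ[yc Zc]].
    by split=> //; apply: lt_trans yc.
  - rewrite size_cat sz0 /= mulnS.
    case: tsz => [|[[a [b [al bl ab nab]]]] kt].
      by move=> ?; left; rewrite leq_add2l.
    right; split; first by exists a, b; split=> //; exact: sub.
    case: l {IH yl gaps bad sub tZ ymin al bl} kt => [|z l] /= kt; first by rewrite muln0.
    by rewrite mulnS leq_add2l.
exists t; split=> //.
  by move=> c /tZ[yc Zc]; split=> //; apply: lt_trans yc.
case: tsz => [kt|[[a [b [al bl ab nab]]]] _].
  by right; split=> //; exists x, y; split=> //; rewrite !inE eqxx ?orbT.
exfalso; apply: (bad x y a b) => //; rewrite ?inE ?eqxx ?orbT //.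
- exact: sub.
- exact: sub.
- exact: ymin.
Qed.

Lemma sort_lt_sorted (R : realType) (s : seq R) : uniq s -> sorted <%R (sort <=%R s).
Proof.
by move=> us; rewrite lt_sorted_uniq_le sort_uniq us /= sort_sorted //; exact: le_total.
Qed.

Lemma rolle_zeros (R : realType) (f df : R -> R) (s : seq R) :
  (forall x : R, is_derive x 1 f (df x)) ->
  uniq s -> (forall x, x \in s -> f x = 0) ->
  exists t, [/\ uniq t, forall x, x \in t -> df x = 0 & ((size s).-1 <= size t)%N].
Proof.
move=> fdf us s0.
have := sort_lt_sorted us.
have : forall x, x \in sort <=%R s -> f x = 0 by move=> x; rewrite mem_sort; apply: s0.
rewrite -(size_sort <=%R s).
case: (sort <=%R s) => [|x l] l0 /= xl; first by exists [::].
have [//||? ? ? ? _ _ _ _ _ _ _|t [st tZ tsz]] :=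
  @sorted_subgaps R (fun _ _ => True) (fun c => df c = 0) 1 x l; last 1 first.
- exists t; split.
  + by move: st; rewrite lt_sorted_uniq_le => /andP[].
  + by move=> c /tZ[].
  + case: tsz; first by rewrite mul1n.
    by move=> [[a [b [_ _ _]]]]; case.
- move=> a b al bl ab _.
  have [c acb] := mvt_cc ab (fun x _ => fdf x).
  rewrite !l0 // subrr => /esym/eqP; rewrite mulf_eq0 subr_eq0 (gt_eqF ab) orbF.
  by move=> /eqP c0; exists [:: c]; split=> // z; rewrite inE => /eqP->.
- by case.
Qed.

Section ExpPoly.
Variable R : realType.
Implicit Types (s : seq (R * {poly R})) (x : R).

Definition exppoly s x : R := \sum_(q <- s) q.2.[x] * expR (q.1 * x).

Definition exppoly_deriv s : seq (R * {poly R}) :=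
  [seq (q.1, q.2^`() + q.1 *: q.2) | q <- s].

Definition exppoly_shift (a : R) s := [seq (q.1 + a, q.2) | q <- s].

Lemma exppoly_shiftE a s x : exppoly (exppoly_shift a s) x = exppoly s x * expR (a * x).
Proof.
rewrite /exppoly big_map mulr_suml; apply: eq_bigr => q _ /=.
by rewrite mulrDl expRD mulrA.
Qed.

Lemma is_derive_exppoly s x : is_derive x 1 (exppoly s) (exppoly (exppoly_deriv s) x).
Proof.
elim: s => [|q s IH].
  rewrite /exppoly /exppoly_deriv big_nil.
  rewrite (_ : (fun _ => _) = cst 0); first exact: is_derive_cst.
  by apply: funext => y; rewrite big_nil.
rewrite (_ : exppoly _ = (fun y => q.2.[y] * expR (q.1 * y)) + exppoly s); last first.
  by apply: funext => y; rewrite /exppoly big_cons.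
rewrite {2}/exppoly /exppoly_deriv /= big_cons -/(exppoly_deriv s) -/(exppoly _ x).
apply: is_deriveD.
have hc : is_derive x 1 (fun y => expR (q.1 * y)) (expR (q.1 * x) * q.1).
  apply: (@is_derive1_comp _ expR (fun y => q.1 * y)).
  apply: is_derive_eq.
  by rewrite -[RHS]mulr1.
apply: (is_derive_eq (@is_deriveM _ _ (horner q.2) _ x 1 _ _ _ hc)) => /=.
rewrite hornerD hornerZ /GRing.scale /=; ring.
Qed.

Lemma leq_size_deriv (p : {poly R}) : (size p^`() <= size p)%N.
Proof.
have [->|/lt_size_deriv/ltnW//] := eqVneq p 0.
by rewrite deriv0.
Qed.

(* Rolle applied to exppoly s / expR (q.1 * x) lowers the degree of the coefficient
   of q and no other degree increases. *)
Lemma exppoly_zeros s (z : seq R) :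
  (exists x, exppoly s x != 0) -> uniq z ->
  (forall x, x \in z -> exppoly s x = 0) ->
  (size z < \sum_(q <- s) size q.2)%N.
Proof.
(* The number of terms enters the measure because dropping a zero coefficient leaves the sum of the
   sizes unchanged. *)
have [n] := ubnP ((\sum_(q <- s) size q.2) + size s)%N.
elim: n s z => // n IH [|[a p] s] z.
  by move=> _ [x]; rewrite /exppoly [X in X != 0]big_nil eqxx.
rewrite big_cons /= addnS ltnS => sz [x sx] uz z0.
have [p0|p0] := eqVneq p 0.
  rewrite p0 size_poly0 add0n in sz *.
  have E y : exppoly ((a, p) :: s) y = exppoly s y.
    by rewrite /exppoly big_cons /= p0 horner0 mul0r add0r.
  apply: IH => //; first by exists x; rewrite -E.
  by move=> y /z0; rewrite E.
pose s1 := exppoly_shift (- a) ((a, p) :: s).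
pose s2 := exppoly_deriv s1.
have s1z y : y \in z -> exppoly s1 y = 0.
  by move=> /z0; rewrite exppoly_shiftE => ->; rewrite mul0r.
have s1x : exppoly s1 x != 0.
  by rewrite exppoly_shiftE mulf_neq0// gt_eqF// expR_gt0.
have szp : (size p^`() < size p)%N by exact: lt_size_deriv.
have sz2 : (\sum_(q <- s2) size q.2 < size p + \sum_(q <- s) size q.2)%N.
  rewrite /s2 /s1 /exppoly_deriv /exppoly_shift /= big_cons /= subrr scale0r addr0.
  rewrite -addSn leq_add // -map_comp big_map leq_sum // => q _ /=.
  apply: (leq_trans (size_polyD _ _)); rewrite geq_max size_scale_leq andbT.
  exact: leq_size_deriv.
have [[y y0]|/forallNP s20] := pselect (exists y, exppoly s2 y != 0).
  have [t [ut t0 zt]] := rolle_zeros (is_derive_exppoly s1) uz s1z.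
  have : (size t < \sum_(q <- s2) size q.2)%N.
    apply: IH => //; last by exists y.
    apply: leq_trans sz; rewrite -/s2 !size_map /= addnS !ltnS.
    by rewrite -addSn leq_add2r.
  move=> tlt; apply: leq_ltn_trans sz2; apply: leq_trans tlt.
  exact: leq_trans (leqSpred _) _.
have {}s20 y : exppoly s2 y = 0 by apply/eqP/negP => /negP /s20.
(* With zero derivative the shifted function is a nonzero constant: it has no zeros, and the strict
   bound follows from [p != 0]. *)
have cst y : exppoly s1 y = exppoly s1 x.
  apply: (@is_derive_0_is_cst _ (exppoly s1)) => w.
  rewrite -(s20 w); exact: is_derive_exppoly.
case: z {uz z0} s1z => [|y z] s1z; first by rewrite /= addn_gt0 size_poly_gt0 p0.
by move: s1x; rewrite -(cst y) s1z ?eqxx // mem_head.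
Qed.

(** Linear independence of exponentials over the polynomials. After shifting the first frequency [a]
    to 0 and differentiating, induction gives [q.2^]() + (q.1 - a) *: q.2 =
    0[for the other terms, hence]q.2 = 0[, and]p^[() = 0] for the first; evaluation at 0 then kills
    [p]. *)
Lemma exppoly_eq0 s : uniq (unzip1 s) -> (forall x, exppoly s x = 0) ->
  forall q, q \in s -> q.2 = 0.
Proof.
have [n] := ubnP ((\sum_(q <- s) size q.2) + size s)%N.
elim: n s => // n IH [|[a p] s] //.
rewrite big_cons /= addnS ltnS => sz /andP[as_ us] s0.
have [p0|p0] := eqVneq p 0.
  rewrite p0 size_poly0 add0n in sz *.
  move=> q; rewrite inE => /predU1P[->//|qs]; apply: (IH s) => // y.
  by rewrite -(s0 y) /exppoly big_cons /= p0 horner0 mul0r add0r.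
pose s1 := exppoly_shift (- a) ((a, p) :: s).
pose s2 := exppoly_deriv s1.
have s10 y : exppoly s1 y = 0 by rewrite exppoly_shiftE s0 mul0r.
have szp : (size p^`() < size p)%N by exact: lt_size_deriv.
have s20 y : exppoly s2 y = 0.
  have := is_derive_exppoly s1 y.
  rewrite (_ : exppoly s1 = cst 0); last exact: funext.
  by move=> /(@derive_val _ _ _ _ _ _ _) <-; rewrite derive_cst.
have s2all : forall q, q \in s2 -> q.2 = 0.
  apply: IH => //.
    apply: leq_trans sz.
    rewrite /s2 /s1 /exppoly_deriv /exppoly_shift /= big_cons /= subrr scale0r addr0.
    rewrite !size_map /= addnS !ltnS -addSn leq_add2r.
    rewrite -addSn leq_add // -map_comp big_map leq_sum // => q _ /=.
    apply: (leq_trans (size_polyD _ _)); rewrite geq_max size_scale_leq andbT.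
    exact: leq_size_deriv.
  rewrite /s2 /s1 /exppoly_deriv /exppoly_shift /unzip1 -!map_comp.
  rewrite (_ : map _ _ = [seq x - a | x <- a :: unzip1 s]); last first.
    by rewrite /unzip1 /= -map_comp.
  rewrite map_inj_uniq /=; first by rewrite as_.
  exact: addIr.
have s0all q : q \in s -> q.2 = 0.
  move=> qs; apply/eqP/negPn/negP => q0.
  have qa : q.1 - a != 0.
    by rewrite subr_eq0; apply: contraNneq as_ => <-; rewrite map_f.
  have : (q.1 - a, q.2^`() + (q.1 - a) *: q.2) \in s2.
    rewrite /s2 /s1 /exppoly_deriv /exppoly_shift -map_comp.
    by apply/mapP; exists q => //; rewrite inE qs orbT.
  (* At the top degree of [q.2] the derivative has coefficient 0, so only [q.1 - a] times the
     leading coefficient remains. *)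
  move=> /s2all /= /(congr1 (fun r : {poly R} => r`_(size q.2).-1)).
  rewrite coefD coefZ coef0 coef_deriv prednK ?size_poly_gt0 //.
  rewrite nth_default // mul0rn add0r => /eqP.
  by rewrite mulf_eq0 (negPf qa) /= -lead_coefE lead_coef_eq0 (negPf q0).
exfalso; move: p0; apply/negP; rewrite negbK; apply/eqP.
have p'0 : p^`() = 0.
  have /s2all /= : (a - a, p^`() + (a - a) *: p) \in s2 by exact: mem_head.
  by rewrite subrr scale0r addr0.
have := s0 0; rewrite /exppoly big_cons big_seq big1 ?addr0 /=; last first.
  by move=> q /s0all ->; rewrite horner0 mul0r.
rewrite mulr0 expR0 mulr1.
rewrite horner_coef0 => p00; apply/polyP => -[|i]; rewrite coef0 //.
have := coef_deriv p i; rewrite p'0 coef0 => /esym/eqP.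
by rewrite mulrn_eq0 => /eqP.
Qed.
End ExpPoly.

(** * The critical equation as a function of the abscissa *)

(** Sublevel sets of a convex quadratic are intervals: the value at [b] is the chord value minus a
    positive defect. *)
Lemma parabola_sublevel (R : realFieldType) (D a b c : R) : a < b -> b < c ->
  (1 + a) ^+ 2 - D * a < 0 -> 0 < (1 + b) ^+ 2 - D * b ->
  (1 + c) ^+ 2 - D * c < 0 -> False.
Proof.
rewrite -(subr_gt0 a b) -(subr_gt0 b c) => ab bc fa fb fc.
have := mulr_gt0 (addr_gt0 ab bc) fb.
rewrite (_ : (b - a + (c - b)) * ((1 + b) ^+ 2 - D * b) = (c - b) * ((1 + a) ^+ 2 - D * a)
  + (b - a) * ((1 + c) ^+ 2 - D * c) - (b - a) * (c - b) * (b - a + (c - b))); last by ring.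
have h1 : (c - b) * ((1 + a) ^+ 2 - D * a) < 0 by rewrite pmulr_rlt0.
have h2 : (b - a) * ((1 + c) ^+ 2 - D * c) < 0 by rewrite pmulr_rlt0.
have h3 := mulr_gt0 (mulr_gt0 ab bc) (addr_gt0 ab bc).
by rewrite ltNge subr_le0 (le_trans _ (ltW h3)) // -oppr_ge0 opprD addr_ge0 // oppr_ge0 ltW.
Qed.

Section Core.
Variables (R : realType) (D Q M : R).
Implicit Types (k l x : R).

Let Dl := D * M - Q ^+ 2.

Definition odds k x := k * expR x.
(* On the critical set nu = b * rho, where b is the coordinate along g *)
Definition rho k x := Q + (Q - D) * odds k x.
Definition nu k x := x + (x - D) * odds k x.

(** This is the derivative of [logit] multiplied by [D * (nu * (Q - x)) * rho ^+ 2], with [nu]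
    eliminated through [rho = nu + (1 + odds) * (Q - x)]. *)
Definition hess k x :=
  let e := odds k x in let z := Q - x in let r := rho k x in
  D * r ^+ 3 - z * r ^+ 2 * (Q ^+ 2 + (Q - D) ^+ 2 * e + Dl * (1 + e))
  + z ^+ 2 * r * (r ^+ 2 + Dl * (1 + e) ^+ 2 + Dl * D * e)
  - z ^+ 3 * Dl * D * e * (1 + e).

(* Horner coefficients with respect to Q - x instead of x *)
Definition shifted_poly (c : seq R) : {poly R} := Poly c \Po (Q%:P - 'X).

Lemma horner_shifted_poly c x : (shifted_poly c).[x] = horner_rec c (Q - x).
Proof. by rewrite horner_comp !hornerE horner_Poly. Qed.

Lemma size_QBX : size (Q%:P - 'X : {poly R}) = 2.
Proof. by rewrite -opprB size_polyN size_XsubC. Qed.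

Lemma size_shifted_poly c : (size (shifted_poly c) <= size c)%N.
Proof. by rewrite size_comp_poly2 ?size_QBX // size_Poly. Qed.

(** [hess] sorted by powers of [expR x]. The cubic term in [Q - x] carries the factor [e * (1 + e)],
    so it occurs at frequencies 1 and 2 only; the sizes are at most 3, 4, 4, 3. *)
Definition hess_exppoly k : seq (R * {poly R}) :=
  let T := Q - D in let q := Q ^+ 2 + Dl in let t := T ^+ 2 + Dl in
  [:: (0, shifted_poly [:: D * Q ^+ 3; - Q ^+ 2 * q; Q * q]);
      (1, shifted_poly [:: k * (3 * D * Q ^+ 2 * T);
            - k * (2 * Q * T * q + Q ^+ 2 * t);
            k * (3 * Q ^+ 2 * T + Dl * (T + 2 * Q) + Dl * D * Q); - k * Dl * D]);
      (2, shifted_poly [:: k ^+ 2 * (3 * D * Q * T ^+ 2);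
            - k ^+ 2 * (T ^+ 2 * q + 2 * Q * T * t);
            k ^+ 2 * (3 * Q * T ^+ 2 + Dl * (Q + 2 * T) + Dl * D * T);
            - k ^+ 2 * Dl * D]);
      (3, shifted_poly [:: k ^+ 3 * (D * T ^+ 3); - k ^+ 3 * (T ^+ 2 * t);
            k ^+ 3 * (T * t)])].

Lemma hessE k x : hess k x = exppoly (hess_exppoly k) x.
Proof.
rewrite /exppoly !big_cons big_nil /= !horner_shifted_poly /= (mul0r x) expR0 (mul1r x).
rewrite !expRM_natl /hess /rho /odds; ring.
Qed.

Lemma hess_continuous k : continuous (hess k).
Proof.
rewrite (_ : hess k = exppoly (hess_exppoly k)); last by apply: funext => x; exact: hessE.
move=> x; apply: differentiable_continuous; apply/derivable1_diffP.
by have [] := is_derive_exppoly (hess_exppoly k) x.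
Qed.

Lemma hess_zeros k (z : seq R) : k != 0 -> Dl != 0 -> D != 0 ->
  uniq z -> (forall x, x \in z -> hess k x = 0) -> (size z <= 13)%N.
Proof.
move=> k0 Dl0 D0 uz z0; rewrite -ltnS.
have : (size z < \sum_(q <- hess_exppoly k) size q.2)%N.
  apply: exppoly_zeros => //; last by move=> x /z0; rewrite hessE.
  apply: contrapT => /forallNP H0.
  have H x : exppoly (hess_exppoly k) x = 0 by apply/eqP/negPn/negP; exact: H0.
  have uq : uniq (unzip1 (hess_exppoly k)).
    by rewrite /= !inE -[0]/(0%:R) -[1]/(1%:R) !eqr_nat.
  (* The cubic coefficient at frequency 1 is [- k * Dl * D], which is nonzero, so [hess] is not
     identically zero. *)
  have m1 : nth (0, 0) (hess_exppoly k) 1 \in hess_exppoly k by exact: mem_nth.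
  have := exppoly_eq0 uq H m1.
  move=> /eqP; rewrite /= comp_poly2_eq0 ?size_QBX // => /eqP.
  move=> /(congr1 (fun p : {poly R} => p`_3)); rewrite coef_Poly coef0 /= => /eqP.
  by rewrite !mulf_eq0 oppr_eq0 (negPf k0) (negPf Dl0) (negPf D0).
move=> /leq_trans; apply.
rewrite !big_cons big_nil /= addn0.
by rewrite (_ : 14 = 3 + (4 + (4 + 3)))%N // !leq_add // size_shifted_poly.
Qed.

(** At a critical point with abscissa [x] one has [nu / (Q - x) = b / (1 - a - b)] and
    [nu / rho = b], while [D * a + Q * b = x] gives [Q * a + M * b = x * Q / D + Dl / D * b]. So
    this is [ln (b / (1 - a - b)) - (Q * a + M * b)]. *)
Definition logit k x := ln (nu k x / (Q - x)) - x * Q / D - Dl / D * (nu k x / rho k x).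

Lemma odds_gt0 k x : 0 < k -> 0 < odds k x.
Proof. by move=> k0; rewrite mulr_gt0 ?expR_gt0. Qed.

Lemma nu_rho k x : rho k x = nu k x + (1 + odds k x) * (Q - x).
Proof. rewrite /rho /nu; ring. Qed.

Lemma is_derive_odds k (x : R) : is_derive x 1 (odds k) (odds k x).
Proof.
exact: (@is_deriveZ _ _ _ expR k x 1 _ (is_derive_expR x)).
Qed.

Lemma is_derive_affine_mul (f o : R -> R) (x a b d da : R) :
  (forall y, f y = a + da * y + (b + da * y) * o y) -> is_derive x 1 o d ->
  is_derive x 1 f (da + (da * o x + (b + da * x) * d)).
Proof.
move=> fE oP.
have -> : f = (cst a + da *: id) + (cst b + da *: id) * o.
  by apply: funext => y; rewrite fE !fctE.
have iP c : is_derive x 1 (cst c + da *: id) (0 + da *: 1).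
  exact: is_deriveD (is_derive_cst c x 1) (is_deriveZ da (is_derive_id x 1)).
apply: (is_derive_eq (is_deriveD (iP a) (is_deriveM (iP b) oP))).
by rewrite !fctE /GRing.scale /=; ring.
Qed.

Lemma is_derive_rho k (x : R) : is_derive x 1 (rho k) ((Q - D) * odds k x).
Proof.
have rhoE y : rho k y = Q + 0 * y + (Q - D + 0 * y) * odds k y by rewrite /rho; ring.
have := is_derive_affine_mul rhoE (is_derive_odds k x).
by rewrite !mul0r !add0r addr0.
Qed.

Lemma is_derive_nu k (x : R) : is_derive x 1 (nu k) (1 + (1 + x - D) * odds k x).
Proof.
have nuE y : nu k y = 0 + 1 * y + (- D + 1 * y) * odds k y by rewrite /nu; ring.
have := is_derive_affine_mul nuE (is_derive_odds k x).
by congr is_derive; ring.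
Qed.

Lemma is_derive_div (f g : R -> R) (x df dg : R) : g x != 0 ->
  is_derive x 1 f df -> is_derive x 1 g dg ->
  is_derive x 1 (fun y => f y / g y) (df / g x - f x * dg / g x ^+ 2).
Proof.
move=> g0 fP gP; have gV := is_deriveV g0 gP.
apply: (is_derive_eq (is_deriveM fP gV)).
by rewrite /GRing.scale /=; field.
Qed.

(** Since [nu] and [Q - x] have the same sign, the argument of [ln] is positive and [rho], a
    positive combination of both, does not vanish. *)
Lemma is_derive_logit k (x : R) : 0 < k -> D != 0 -> 0 < nu k x * (Q - x) ->
  is_derive x 1 (logit k) (hess k x * (D * (nu k x * (Q - x)) * rho k x ^+ 2)^-1).
Proof.
move=> k0 D0 nz.
have u0 : 0 < 1 + odds k x by rewrite addr_gt0 ?odds_gt0.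
have Q0 : Q - x != 0 by apply: contraTneq nz => ->; rewrite mulr0 ltxx.
have nu0 : nu k x != 0 by apply: contraTneq nz => ->; rewrite mul0r ltxx.
have rho0 : rho k x != 0.
  rewrite nu_rho; apply: contraTneq nz => /eqP; rewrite addr_eq0 => /eqP ->.
  by rewrite mulNr oppr_gt0 -leNgt -mulrA mulr_ge0 ?(ltW u0) // -expr2 sqr_ge0.
have div0 : 0 < nu k x / (Q - x).
  by rewrite -(@pmulr_lgt0 _ ((Q - x) ^+ 2)) ?exprn_even_gt0 // expr2 mulrA divfK.
have nuP := is_derive_nu k x.
have rhoP := is_derive_rho k x.
have QP : is_derive x 1 (fun y : R => Q - y) (-1).
  rewrite (_ : (fun y => _) = cst Q - id) //.
  by apply: is_derive_eq; rewrite sub0r.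
have divP := @is_derive_div (nu k) (fun y => Q - y) x _ _ Q0 nuP QP.
have lnP := @is_derive1_comp _ (@ln R) _ x _ _ (is_derive1_ln div0) divP.
have ratP := @is_derive_div (nu k) (rho k) x _ _ rho0 nuP rhoP.
rewrite (_ : logit k = (ln (R:=R) \o (fun y => nu k y / (Q - y))) - (Q / D) *: id
    - (Dl / D) *: (fun y => nu k y / rho k y)); last first.
  apply: funext => y; rewrite /logit !fctE /GRing.scale /=.
  by rewrite -[y * Q / D]mulrA [y * (Q / D)]mulrC.
apply: is_derive_eq.
rewrite /GRing.scale /= /hess.
move: nu0 rho0; rewrite /nu /rho /Dl; move: (odds k x) => e nu0 rho0.
field.
by rewrite ?D0 ?nu0 ?rho0 ?Q0.
Qed.

(* S - D * sigma S with sigma logistic; it has the sign of nu and a simpler derivative *)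
Definition excess k x := x - D * (odds k x / (1 + odds k x)).

Lemma nu_excess k x : 0 < k -> nu k x = (1 + odds k x) * excess k x.
Proof.
move=> k0; have u0 : 1 + odds k x != 0 by rewrite gt_eqF// addr_gt0 ?odds_gt0.
by rewrite /nu /excess; field.
Qed.

Lemma is_derive_excess k (x : R) : 0 < k ->
  is_derive x 1 (excess k) (1 - D * odds k x / (1 + odds k x) ^+ 2).
Proof.
move=> k0; have u0 : 1 + odds k x != 0 by rewrite gt_eqF// addr_gt0 ?odds_gt0.
have oddsP := is_derive_odds k x.
have uP : is_derive x 1 (fun y => 1 + odds k y) (odds k x).
  rewrite (_ : (fun y => _) = cst 1 + odds k) //.
  by apply: is_derive_eq; rewrite add0r.
have divP := @is_derive_div _ (fun y => 1 + odds k y) x _ _ u0 oddsP uP.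
rewrite (_ : excess k = id - D *: (fun y => odds k y / (1 + odds k y))) //.
by apply: is_derive_eq; rewrite /GRing.scale /=; field.
Qed.

(** The mean value theorem gives derivatives of signs -, +, - at increasing points. Up to the factor
    [(1 + odds) ^+ 2] the derivative is a convex quadratic in [odds], which increases with [x], so
    this sign pattern is impossible. *)
Lemma excess_pattern k x1 x2 x3 x4 : 0 < k -> x1 < x2 -> x2 < x3 -> x3 < x4 ->
  excess k x2 < excess k x1 -> excess k x2 < excess k x3 ->
  excess k x4 < excess k x3 -> False.
Proof.
move=> k0 x12 x23 x34 f12 f23 f34.
pose df x := 1 - D * odds k x / (1 + odds k x) ^+ 2.
have dfP a b : forall y : R, a <= y <= b -> is_derive y 1 (excess k) (df y).
  by move=> y _; exact: is_derive_excess.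
have [y1 /andP[a1 b1] e1] := mvt_cc x12 (dfP _ _).
have [y2 /andP[a2 b2] e2] := mvt_cc x23 (dfP _ _).
have [y3 /andP[a3 b3] e3] := mvt_cc x34 (dfP _ _).
have d1 : df y1 < 0.
  by move: f12; rewrite -subr_lt0 e1 pmulr_llt0 // subr_gt0.
have d2 : 0 < df y2.
  by move: f23; rewrite -subr_gt0 e2 pmulr_lgt0 // subr_gt0.
have d3 : df y3 < 0.
  by move: f34; rewrite -subr_lt0 e3 pmulr_llt0 // subr_gt0.
have o12 : odds k y1 < odds k y2.
  by rewrite ltr_pM2l // ltr_expR (lt_trans b1).
have o23 : odds k y2 < odds k y3.
  by rewrite ltr_pM2l // ltr_expR (lt_trans b2).
have dfE x : df x * (1 + odds k x) ^+ 2 = (1 + odds k x) ^+ 2 - D * odds k x.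
  by rewrite /df; field; rewrite gt_eqF// addr_gt0 ?odds_gt0.
have u2 x : 0 < (1 + odds k x) ^+ 2 by rewrite exprn_gt0// addr_gt0 ?odds_gt0.
move: d1 d2 d3.
rewrite -(pmulr_llt0 (df y1) (u2 y1)) -(pmulr_lgt0 (df y2) (u2 y2)).
rewrite -(pmulr_llt0 (df y3) (u2 y3)) !dfE.
move: (odds k y1) (odds k y2) (odds k y3) o12 o23 (odds_gt0 y1 k0) => a b c ab bc a0.
exact: parabola_sublevel.
Qed.

End Core.

(** * Counting abscissas *)

Lemma ivt_lt (R : realType) (f : R -> R) (a b : R) : continuous f -> a < b ->
  f a * f b < 0 -> exists2 c, a < c < b & f c = 0.
Proof.
move=> fc ab fab.
have [||c] := @IVT R f a b 0 (ltW ab).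
- exact: continuous_subspaceT.
- rewrite ge_min le_max; have [fa|fa] := lerP (f a) 0.
    apply/orP; right; rewrite leNgt; apply: contraTN fab => fb.
    by rewrite -leNgt mulr_le0 // ltW.
  rewrite (ltW fa) /= andbT leNgt; apply: contraTN fab => fb.
  by rewrite -leNgt ltW ?mulr_gt0.
- rewrite in_itv /= => /andP[ac cb] fc0; exists c => //.
  rewrite !lt_neqAle ac cb !andbT; apply/andP; split.
  + by apply: contraTneq fab => ->; rewrite fc0 mul0r ltxx.
  + by apply: contraTneq fab => <-; rewrite fc0 mulr0 ltxx.
Qed.

(** [f] increases just after [a] but must return to [f a] at [b], so [h] is negative somewhere in
    between and changes sign twice. *)
Lemma two_critical (R : realType) (f h g : R -> R) (a b : R) : a < b ->
  (forall x : R, a <= x <= b -> is_derive x 1 f (h x * g x)) ->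
  (forall x, a <= x <= b -> 0 < g x) -> continuous h -> f a = f b ->
  0 < h a -> 0 < h b ->
  exists c d, [/\ a < c, c < d, d < b, h c = 0 & h d = 0].
Proof.
move=> ab fP gP hc fab ha hb.
have : \forall y \near a, 0 < h y by exact: (cvgr_gt (h a) (hc a) 0 ha).
move=> /nbhs_ballP[e /= e0 he].
(* A point before [b] and so close to [a] that [h] is positive on all of [[a, x]]. *)
pose x := a + Num.min (e / 2) ((b - a) / 2).
have m0 : 0 < Num.min (e / 2) ((b - a) / 2).
  by rewrite lt_min !divr_gt0 // subr_gt0.
have ax : a < x by rewrite ltrDl.
have xb : x < b.
  rewrite /x -ltrBrDl gt_min; apply/orP; right.
  by rewrite ltr_pdivrMr // ltr_pMr ?subr_gt0 // ltr1n.
have hx y : a <= y <= x -> 0 < h y.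
  move=> /andP[ay yx]; apply: he; rewrite /ball /= distrC ger0_norm ?subr_ge0 //.
  rewrite ltrBlDl; apply: (le_lt_trans yx); rewrite ltrD2l gt_min; apply/orP; left.
  by rewrite ltr_pdivrMr // ltr_pMr // ltr1n.
have [y|y1 /andP[ay1 y1x] e1] := @mvt_cc R f (fun x => h x * g x) a x ax.
  by move=> /andP[ay yx]; apply: fP; rewrite ay (le_trans yx) // ltW.
have [y|y2 /andP[xy2 y2b] e2] := @mvt_cc R f (fun x => h x * g x) x b xb.
  by move=> /andP[ay yx]; apply: fP; rewrite yx andbT (le_trans _ ay) // ltW.
have fx : 0 < f x - f a.
  rewrite e1 !mulr_gt0 ?subr_gt0 //; first by apply: hx; rewrite !ltW.
  by apply: gP; rewrite !ltW // (lt_trans y1x).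
have hy2 : h y2 < 0.
  move: fx; rewrite fab -opprB e2 oppr_gt0 pmulr_llt0 ?subr_gt0 // pmulr_llt0 //.
  by apply: gP; rewrite !ltW // (lt_trans ax).
have [||c /andP[ac cy] c0] := @ivt_lt _ h a y2 hc; first exact: lt_trans xy2.
  by rewrite pmulr_rlt0.
have [|d /andP[yd db] d0] := @ivt_lt _ h y2 b hc y2b; first by rewrite pmulr_llt0.
by exists c, d; split=> //; apply: lt_trans yd.
Qed.

Section Count.
Variables (R : realType) (D Q M : R).
Implicit Types (k l x : R) (s : seq R).

Let Dl := D * M - Q ^+ 2.

Hypotheses (D0 : 0 < D) (Dl0 : 0 < Dl).

(* Equivalent to 0 < nu / rho < 1, since rho = nu + (1 + odds) * (Q - x) *)
Definition admissible k x := 0 < nu D k x * (Q - x).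

Notation hess := (hess D Q M).
Notation logit := (logit D Q M).

Lemma admissible_excess k x : 0 < k -> admissible k x = (0 < excess D k x * (Q - x)).
Proof.
by move=> k0; rewrite /admissible nu_excess // -mulrA pmulr_rgt0 // addr_gt0 ?odds_gt0.
Qed.

Lemma admissible_neq k x : admissible k x -> x != Q.
Proof. by apply: contraTneq => ->; rewrite /admissible subrr mulr0 ltxx. Qed.

(* Two bad gaps would make excess decrease, increase and decrease again. *)
Lemma bad_gap_unique k a b c d : 0 < k -> admissible k a -> admissible k b ->
  admissible k c -> admissible k d -> a < b -> b <= c -> c < d ->
  ~ (forall x, a <= x <= b -> admissible k x) ->
  ~ (forall x, c <= x <= d -> admissible k x) -> False.
Proof.
move=> k0 Aa Ab Ac Ad ab bc cd.
have bad u v : admissible k u -> admissible k v ->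
    ~ (forall x, u <= x <= v -> admissible k x) ->
    exists x, [/\ u < x, x < v & excess D k x * (Q - x) <= 0].
  move=> Au Av /existsNP[x /not_implyP[/andP[ux xv] /negP]].
  move=> nx; exists x; rewrite leNgt -admissible_excess // nx.
  rewrite !lt_neqAle ux xv !andbT; split=> //.
    by apply: contraNneq nx => <-.
  by apply: contraNneq nx => ->.
move=> /(bad _ _ Aa Ab)[x [ax xb ex]] /(bad _ _ Ac Ad)[y [cy yd ey]].
have := (admissible_neq Aa, admissible_neq Ab, admissible_neq Ac, admissible_neq Ad).
move: Aa Ab Ac Ad; rewrite !admissible_excess // => Aa Ab Ac Ad [[[aQ bQ] cQ] dQ].
have pos z : z < Q -> 0 < excess D k z * (Q - z) -> 0 < excess D k z.
  by move=> zQ; rewrite pmulr_lgt0 // subr_gt0.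
have neg z : Q < z -> 0 < excess D k z * (Q - z) -> excess D k z < 0.
  by move=> zQ; rewrite nmulr_lgt0 // subr_lt0.
have npos z : z < Q -> excess D k z * (Q - z) <= 0 -> excess D k z <= 0.
  by move=> zQ; rewrite pmulr_lle0 // subr_gt0.
have nneg z : Q < z -> excess D k z * (Q - z) <= 0 -> 0 <= excess D k z.
  by move=> zQ; rewrite nmulr_lle0 // subr_lt0.
have by_ := le_lt_trans bc cy; have xy := lt_trans xb by_.
(* At admissible points [excess] is positive left of [Q] and negative right of it; at [x] and [y]
   the signs are opposite or zero. The position of [Q] decides which four points form the forbidden
   pattern. *)
have [dQ'|Qd] := ltP d Q.
  have yQ := lt_trans yd dQ'; have bQ' := lt_trans by_ yQ.
  have xQ := lt_trans xb bQ'; have aQ' := lt_trans ax xQ.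
  apply: (@excess_pattern R D k a x b y k0) => //.
  - exact: le_lt_trans (npos _ xQ ex) (pos _ aQ' Aa).
  - exact: le_lt_trans (npos _ xQ ex) (pos _ bQ' Ab).
  - exact: le_lt_trans (npos _ yQ ey) (pos _ bQ' Ab).
have {}Qd : Q < d by rewrite lt_neqAle eq_sym dQ.
have ed := neg _ Qd Ad.
have [Qa|aQ'] := ltP Q a.
  have Qx := lt_trans Qa ax; have Qb := lt_trans Qx xb; have Qy := lt_trans Qb by_.
  apply: (@excess_pattern R D k x b y d k0) => //.
  - exact: lt_le_trans (neg _ Qb Ab) (nneg _ Qx ex).
  - exact: lt_le_trans (neg _ Qb Ab) (nneg _ Qy ey).
  - exact: lt_le_trans ed (nneg _ Qy ey).
have {}aQ' : a < Q by rewrite lt_neqAle aQ.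
have ea := pos _ aQ' Aa.
have [bQ'|Qb] := ltP b Q.
  have xQ := lt_trans xb bQ'; have bd := lt_trans by_ yd.
  apply: (@excess_pattern R D k a x b d k0) => //.
  - exact: le_lt_trans (npos _ xQ ex) ea.
  - exact: le_lt_trans (npos _ xQ ex) (pos _ bQ' Ab).
  - exact: lt_trans ed (pos _ bQ' Ab).
have {}Qb : Q < b by rewrite lt_neqAle eq_sym bQ.
have Qy := lt_trans Qb by_.
apply: (@excess_pattern R D k a b y d k0) => //.
- exact: lt_trans (neg _ Qb Ab) ea.
- exact: lt_le_trans (neg _ Qb Ab) (nneg _ Qy ey).
- exact: lt_le_trans ed (nneg _ Qy ey).
Qed.

Lemma is_derive_logit_admissible k (a b : R) : 0 < k ->
  (forall x, a <= x <= b -> admissible k x) ->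
  exists2 g : R -> R, forall x, a <= x <= b -> 0 < g x &
   forall x : R, a <= x <= b -> is_derive x 1 (logit k) (hess k x * g x).
Proof.
move=> k0 A.
exists (fun x => (D * (nu D k x * (Q - x)) * rho D Q k x ^+ 2)^-1) => x /A Ax.
  rewrite invr_gt0; apply: mulr_gt0; first exact: mulr_gt0.
  rewrite exprn_even_gt0 //=.
  rewrite nu_rho; apply: contraTneq Ax => /eqP; rewrite addr_eq0 /admissible => /eqP ->.
  rewrite mulNr oppr_gt0 -leNgt -mulrA -expr2 mulr_ge0 ?sqr_ge0 //.
  by rewrite ltW // addr_gt0 ?odds_gt0.
by apply: is_derive_logit; rewrite ?gt_eqF.
Qed.

(** The [size s - 1] gaps include at most one that is not admissible throughout; each of the others
    contributes [m] of the at most 13 zeros of [hess]. *)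
Lemma count_admissible (m : nat) k s : 0 < k -> uniq s ->
  (forall x, x \in s -> admissible k x) ->
  (forall a b, a \in s -> b \in s -> a < b ->
    (forall x, a <= x <= b -> admissible k x) ->
    exists t : seq R, [/\ sorted <%R t, size t = m &
      forall c, c \in t -> a < c < b /\ hess k c = 0]) ->
  (m * (size s).-2 <= 13)%N.
Proof.
move=> k0 us sA gaps.
have := sort_lt_sorted us; rewrite -(size_sort <=%R s).
have ms x : x \in sort <=%R s -> x \in s by rewrite mem_sort.
case: (sort <=%R s) ms => [|x l] ms /= xl; first by rewrite muln0.
have [||t [st tZ tsz]] := @sorted_subgaps R
   (fun a b => forall x, a <= x <= b -> admissible k x) (fun c => hess k c = 0) m x l xl.
- by move=> a b /ms al /ms bl ab; apply: gaps.
- move=> a b c d /ms/sA al /ms/sA bl /ms/sA cl /ms/sA dl.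
  exact: bad_gap_unique k0 al bl cl dl.
have : (size t <= 13)%N.
  apply: (@hess_zeros R D Q M k); rewrite ?gt_eqF //.
    by move: st; rewrite lt_sorted_uniq_le => /andP[].
  by move=> c /tZ[].
apply: leq_trans; case: tsz => [|[_ //]].
by apply: leq_trans; rewrite leq_mul2l leq_pred orbT.
Qed.

(** Rolle with one zero per gap: a coarse bound that serves only the finiteness of the set of
    modes. *)
Lemma count_critical k l s : 0 < k -> uniq s ->
  (forall x, x \in s -> admissible k x /\ logit k x = l) -> (size s <= 15)%N.
Proof.
move=> k0 us sP.
have := @count_admissible 1 k s k0 us (fun x xs => (sP x xs).1).
rewrite mul1n => /(_ _); case: (size s) => [|[|n]] //; apply.
move=> a b /sP[_ la] /sP[_ lb] ab /(is_derive_logit_admissible k0)[g g0 dl].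
have [c acb] := mvt_cc ab dl.
rewrite la lb subrr => /esym/eqP; rewrite !mulf_eq0 [b - a == 0]subr_eq0 (gt_eqF ab) orbF.
have gc : 0 < g c by move: acb => /andP[? ?]; rewrite g0 // !ltW.
rewrite (gt_eqF gc) orbF => /eqP c0.
by exists [:: c]; split=> // z; rewrite inE => /eqP->.
Qed.

Lemma count_modes k l s : 0 < k -> uniq s ->
  (forall x, x \in s ->
     [/\ admissible k x, logit k x = l & 0 < (Q - x) * hess k x]) ->
  (size s <= 8)%N.
Proof.
move=> k0 us sP.
suff : (2 * (size s).-2 <= 13)%N by lia.
apply: (@count_admissible 2 k s k0 us); first by move=> x /sP[].
move=> a b /sP[Aa la ha] /sP[Ab lb hb] ab A.
have [g g0 dl] := is_derive_logit_admissible k0 A.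
have hc := @hess_continuous R D Q M k.
have [c [d [ac cd db c0 d0]]] : exists c d,
    [/\ a < c, c < d, d < b, hess k c = 0 & hess k d = 0].
  have [bQ|Qb] := ltP b Q.
    apply: (two_critical ab dl g0 hc); first by rewrite la lb.
      by move: ha; rewrite pmulr_rgt0 // subr_gt0 (lt_trans ab).
    by move: hb; rewrite pmulr_rgt0 // subr_gt0.
  have {}Qb : Q < b by rewrite lt_neqAle eq_sym (admissible_neq Ab).
  (* [Q] is never admissible, so an admissible gap lies on one side of it; on the right the signs
     are reversed and [- logit] is used. *)
  have [Qa|aQ] := ltP Q a; last first.
    by have := admissible_neq (A Q _); rewrite aQ ltW // eqxx => /(_ isT).
  have dlN (x : R) : a <= x <= b -> is_derive x 1 (- logit k) (- hess k x * g x).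
    by move=> /dl lx; rewrite mulNr; apply: is_deriveN.
  have hcN : continuous (fun x => - hess k x) by move=> x; apply: cvgN; exact: hc.
  have [|||c [d [ac cd db /eqP c0 /eqP d0]]] := two_critical ab dlN g0 hcN.
  - by rewrite !fctE la lb.
  - by move: ha; rewrite nmulr_rgt0 ?oppr_gt0 // subr_lt0.
  - by move: hb; rewrite nmulr_rgt0 ?oppr_gt0 // subr_lt0.
  by exists c, d; split=> //; apply/eqP; rewrite -oppr_eq0.
exists [:: c; d]; split=> //=; first by rewrite cd.
move=> z; rewrite !inE => /orP[] /eqP ->; split=> //.
  by rewrite ac (lt_trans cd).
by rewrite db andbT (lt_trans ac).
Qed.

End Count.

(** * Critical barycentric coordinates *)

Section CriticalPairs.
Variables (R : realType) (D Q M : R).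
Implicit Types (k l x a b : R) (s : seq (R * R)).

Let Dl := D * M - Q ^+ 2.

Hypotheses (D0 : 0 < D) (Dl0 : 0 < Dl).

Notation hess := (hess D Q M).
Notation logit := (logit D Q M).

(** The fixed-point equations of the posterior weights at [x = mu_0 + a v + b g], where
    [D * a + Q * b] and [Q * a + M * b] are the products of [x - mu_0] with [v] and [g]. *)
Definition critical k l a b :=
  [/\ 0 < a, 0 < b, a + b < 1,
      a = (1 - a - b) * (k * expR (D * a + Q * b)) &
      b = (1 - a - b) * (l * expR (Q * a + M * b))].

(* det (I - Cov G) for the weights 1 - a - b, a, b: Cov is the covariance of the
   indicators of components 1 and 2, and G the Gram matrix with entries D, Q, M *)
Definition hess_det a b :=
  1 - (D + M - 2 * Q) * (a * b) - M * ((1 - a - b) * b) - D * ((1 - a - b) * a)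
  + Dl * ((1 - a - b) * a * b).

Lemma critical_rest k l a b : critical k l a b ->
  (1 - a - b) * (1 + odds k (D * a + Q * b)) = 1 - b.
Proof.
move=> [_ _ _ aE _].
by rewrite mulrDr mulr1 -[X in _ + X]aE; ring.
Qed.

(** The first critical equation, with [a] eliminated in favour of the abscissa: the difference of
    the two sides is [D] times its defect. *)
Lemma critical_nu k l a b : critical k l a b ->
  nu D k (D * a + Q * b) = b * rho D Q k (D * a + Q * b).
Proof.
move=> [_ _ _ aE _]; apply/eqP; rewrite -subr_eq0.
rewrite (_ : _ - _ = D * (a - (1 - a - b) * odds k (D * a + Q * b))).
  by rewrite -[X in a - X]aE subrr mulr0.
by rewrite /nu /rho; ring.
Qed.

Lemma critical_rho k l a b : critical k l a b ->
  (1 - b) * rho D Q k (D * a + Q * b) =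
  (1 + odds k (D * a + Q * b)) * (Q - (D * a + Q * b)).
Proof.
by move=> /critical_nu nuE; rewrite mulrBl mul1r -nuE nu_rho; ring.
Qed.

Section Crit.
Variables (k l a b : R).
Hypotheses (k0 : 0 < k) (l0 : 0 < l) (C : critical k l a b).
Let S := D * a + Q * b.
Hypothesis (SQ : S != Q).

Let u0 : 0 < 1 + odds k S. Proof. by rewrite addr_gt0 ?odds_gt0. Qed.

Let b1 : 0 < 1 - b.
Proof. by have [a0 _ ab _ _] := C; rewrite subr_gt0 (lt_trans _ ab) // ltrDr. Qed.

Lemma critical_rho_neq0 : rho D Q k S != 0.
Proof.
apply/eqP => r0; have := critical_rho C; rewrite -/S r0 mulr0 => /esym/eqP.
by rewrite mulf_eq0 gt_eqF //= subr_eq0 eq_sym (negPf SQ).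
Qed.

Lemma critical_admissible : admissible D Q k S.
Proof.
rewrite /admissible -(pmulr_rgt0 _ u0) mulrCA -(critical_rho C) (critical_nu C) -/S.
have [_ b0 _ _ _] := C.
rewrite mulrACA -expr2; apply: mulr_gt0; first exact: mulr_gt0.
rewrite exprn_even_gt0 //=.
exact: critical_rho_neq0.
Qed.

Lemma critical_logit : logit k S = ln l.
Proof.
have [_ b0 _ _ bE] := C; have r0 := critical_rho_neq0.
have QS0 : Q - S != 0 by rewrite subr_eq0 eq_sym.
have t0 : 0 < 1 - a - b by rewrite -(pmulr_lgt0 _ u0) (critical_rest C).
have bt : b / (1 - a - b) = l * expR (Q * a + M * b).
  by rewrite {1}bE mulrAC divff ?mul1r // gt_eqF.
rewrite /logit (critical_nu C) -/S mulfK //.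
have -> : b * rho D Q k S / (Q - S) = b / (1 - a - b).
  have <- : rho D Q k S * (1 - a - b) = Q - S.
    apply: (mulfI (lt0r_neq0 u0)).
    by rewrite -(critical_rho C) -(critical_rest C); ring.
  by rewrite [b * _]mulrC -mulf_div divff // mul1r.
rewrite bt lnM ?posrE ?expR_gt0 // expRK /S /Dl; field.
by rewrite gt_eqF.
Qed.

(** Expressing [Q - S] and [a] through [b], [rho] and [odds] turns this into an identity of rational
    functions. It translates the second-order condition in the plane into a sign of [hess]. *)
Lemma critical_hess : hess k S = D * rho D Q k S ^+ 3 * hess_det a b.
Proof.
have r0 := critical_rho_neq0; have u := lt0r_neq0 u0.
have zE : Q - S = (1 - b) * rho D Q k S / (1 + odds k S).
  by rewrite (critical_rho C) -/S mulrAC divff ?mul1r.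
have [_ _ _ aE _] := C.
have aE' : a = (1 - b) * odds k S / (1 + odds k S).
  apply: (mulIf u); rewrite divfK // -(critical_rest C) -/S.
  by rewrite mulrAC -[(1 - a - b) * _]aE.
have rE : rho D Q k S = Q + (Q - D) * odds k S by [].
rewrite /hess /hess_det zE {}aE'.
move: rE r0 u; move: (rho D Q k S) (odds k S) => r e rE r0 u; rewrite /Dl.
by rewrite rE; field.
Qed.

End Crit.

Definition abscissa (p : R * R) := D * p.1 + Q * p.2.

(** The abscissa determines [b = nu / rho], and then [a] because [D] is nonzero. *)
Lemma critical_inj k l p q : 0 < k -> critical k l p.1 p.2 -> critical k l q.1 q.2 ->
  abscissa p != Q -> abscissa p = abscissa q -> p = q.
Proof.
move=> k0 Cp Cq pQ pq; have rp := critical_rho_neq0 k0 Cp pQ.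
have e : p.2 = q.2.
  apply: (mulIf rp); rewrite -(critical_nu Cp).
  by rewrite -/(abscissa p) pq [RHS](_ : _ = q.2 * rho D Q k (abscissa q)) ?pq // -(critical_nu Cq).
move: pq; rewrite /abscissa e => /addIr /(mulfI (lt0r_neq0 D0)) e'.
by rewrite [p]surjective_pairing [q]surjective_pairing e e'.
Qed.

Lemma uniq_abscissa k l s : 0 < k -> uniq s ->
  (forall p, p \in s -> critical k l p.1 p.2 /\ abscissa p != Q) ->
  uniq (map abscissa s).
Proof.
move=> k0 us sP; rewrite map_inj_in_uniq // => p q /sP[Cp pQ] /sP[Cq _].
exact: (critical_inj k0 Cp Cq).
Qed.

(* If rho Q = 0, the critical set contains points with abscissa Q and different
   values of b, which solve an exponential-polynomial equation in b. *)
Lemma count_exceptional k l s : 0 < k -> 0 < l -> uniq s ->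
  (forall p, p \in s -> critical k l p.1 p.2 /\ abscissa p = Q) -> (size s <= 3)%N.
Proof.
move=> k0 l0 us sP.
pose u := 1 + odds k Q.
pose c := Dl / D.
pose l' := l * expR (Q ^+ 2 / D).
have us2 : uniq (map snd s).
  rewrite map_inj_in_uniq // => p q /sP[_ pQ] /sP[_ qQ] e.
  move: pQ; rewrite -qQ /abscissa e => /addIr /(mulfI (lt0r_neq0 D0)) e'.
  by rewrite [p]surjective_pairing [q]surjective_pairing e e'.
rewrite -(size_map snd) -ltnS.
(* At abscissa [Q] one has [1 - a - b = (1 - b) / u] and [Q * a + M * b = Q ^+ 2 / D + c * b], so
   the second critical equation reads [u * b = (1 - b) * l' * expR (c * b)]. Two linear coefficients
   allow three zeros. *)
pose sq : seq (R * {poly R}) := [:: (0, u%:P * 'X); (c, l'%:P * ('X - 1%:P))].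
have sqE b : exppoly sq b = u * b + l' * (b - 1) * expR (c * b).
  by rewrite /exppoly !big_cons big_nil addr0 /= mul0r expR0 mulr1 !hornerE.
have : (size (map snd s) < \sum_(q <- sq) size q.2)%N.
  apply: exppoly_zeros => //.
    exists 0; rewrite sqE mulr0 add0r mulr0 expR0 mulr1 sub0r mulrN1 oppr_eq0.
    by rewrite gt_eqF // mulr_gt0 ?expR_gt0.
  move=> _ /mapP[p /sP[C pQ] ->]; rewrite sqE.
  have := critical_rest C; rewrite -/(abscissa p) pQ -/u => rE.
  have [_ _ _ _ bE] := C.
  have eE : expR (Q * p.1 + M * p.2) = expR (Q ^+ 2 / D) * expR (c * p.2).
    rewrite -expRD; congr expR; rewrite /c /Dl.
    have -> : p.1 = (Q - Q * p.2) / D.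
      by apply: (mulIf (lt0r_neq0 D0)); rewrite divfK ?gt_eqF // -{1}pQ /abscissa; ring.
    by field; rewrite gt_eqF.
  have : u * p.2 = (1 - p.2) * (l' * expR (c * p.2)).
    by rewrite {1}bE eE -rE /l'; ring.
  by move=> ->; ring.
move=> /leq_trans; apply.
rewrite !big_cons big_nil /= addn0 !size_Cmul ?size_XsubC ?size_polyX //.
- by rewrite gt_eqF // mulr_gt0 ?expR_gt0.
- by rewrite gt_eqF // addr_gt0 ?odds_gt0.
Qed.

Lemma count_critical_pairs k l s : 0 < k -> 0 < l -> uniq s ->
  (forall p, p \in s -> critical k l p.1 p.2) -> (size s <= 18)%N.
Proof.
move=> k0 l0 us sC.
pose e : pred (R * R) := fun p => abscissa p == Q.
rewrite -(count_predC e) -!size_filter (_ : 18 = 3 + 15)%N // leq_add //.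
  apply: (@count_exceptional k l) => //; first exact: filter_uniq.
  by move=> p; rewrite mem_filter => /andP[/eqP ? /sC].
rewrite -(size_map abscissa).
have fP p : p \in seq.filter (predC e) s -> critical k l p.1 p.2 /\ abscissa p != Q.
  by rewrite mem_filter => /andP[? /sC].
apply: (@count_critical R D Q M D0 Dl0 k (ln l)) => //.
  by apply: (uniq_abscissa k0 _ fP); exact: filter_uniq.
move=> _ /mapP[p /fP[C pQ] ->]; split; first exact: critical_admissible C pQ.
exact: critical_logit C pQ.
Qed.

(** The first condition excludes critical points with abscissa [Q]; the second makes [ln l] a
    regular value of [logit] on the admissible set. *)
Definition generic k l := rho D Q k Q != 0 /\
  forall x, admissible D Q k x -> logit k x = ln l -> hess k x != 0.

(** At a critical point [(1 + odds) * (Q - S) * hess] equals [(1 - b) * D * hess_det * rho ^+ 4],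
    which is nonnegative; genericity makes it positive, as [count_modes] requires. *)
Lemma count_generic_modes k l s : 0 < k -> 0 < l -> generic k l -> uniq s ->
  (forall p, p \in s -> critical k l p.1 p.2 /\ 0 <= hess_det p.1 p.2) ->
  (size s <= 8)%N.
Proof.
move=> k0 l0 [rQ hG] us sP.
have sQ p : p \in s -> critical k l p.1 p.2 /\ abscissa p != Q.
  move=> /sP[C _]; split=> //; apply: contraNneq rQ => pQ.
  have := critical_rho C; rewrite -/(abscissa p) pQ subrr mulr0 => /eqP.
  have [a0 _ ab _ _] := C.
  by rewrite mulf_eq0 subr_eq0 gt_eqF //= (lt_trans _ ab) // ltrDr.
rewrite -(size_map abscissa).
apply: (@count_modes R D Q M D0 Dl0 k (ln l)) => //.
  exact: (uniq_abscissa k0 us sQ).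
move=> _ /mapP[p ps ->]; have [C pQ] := sQ p ps; have [_ P0] := sP p ps.
have Ap := critical_admissible k0 C pQ; have Lp := critical_logit k0 l0 C pQ.
split=> //; rewrite lt0r mulf_neq0 ?hG ?subr_eq0 1?eq_sym //=.
rewrite (critical_hess k0 C pQ).
have b1 : 0 < 1 - p.2.
  by have [a0 _ ab _ _] := C; rewrite subr_gt0 (lt_trans _ ab) // ltrDr.
have u0 : 0 < 1 + odds k (D * p.1 + Q * p.2) by rewrite addr_gt0 ?odds_gt0.
rewrite /abscissa -(pmulr_rge0 _ u0) (mulrA _ (Q - _)) -(critical_rho C).
move: (rho D Q k _) => r.
have -> : (1 - p.2) * r * (D * r ^+ 3 * hess_det p.1 p.2) =
    (1 - p.2) * D * hess_det p.1 p.2 * (r ^+ 2) ^+ 2 by ring.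
apply: mulr_ge0; last exact: sqr_ge0.
by apply: mulr_ge0 => //; rewrite ltW // mulr_gt0.
Qed.

(* Of 14 distinct values of t' at most 13 are critical values of logit, since
   distinct critical values have distinct critical points. *)
Lemma generic_dense k l (e : R) : 0 < k -> 0 < l -> 0 < e ->
  exists t t', [/\ 1 <= t < 1 + e, 1 <= t' < 1 + e & generic (k * t) (l * t')].
Proof.
move=> k0 l0 e0.
(* [rho] at [Q] is affine in [t]. If it vanished at both 1 and [1 + e / 2], then [Q = D], and [rho]
   would be the constant [D > 0]. *)
have [t t1 rt] : exists2 t, 1 <= t < 1 + e & rho D Q (k * t) Q != 0.
  have e2 : 0 < e / 2 by rewrite divr_gt0.
  have [r0|r0] := eqVneq (rho D Q k Q) 0; last by exists 1; rewrite ?lexx ?mulr1 ?ltrDl.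
  exists (1 + e / 2).
    by rewrite lerDl ltW //= ltrD2l ltr_pdivrMr // ltr_pMr // ltr1n.
  apply/eqP => r1.
  have : (Q - D) * odds k Q * (e / 2) = rho D Q (k * (1 + e / 2)) Q - rho D Q k Q.
    by rewrite /rho /odds; ring.
  rewrite r0 r1 subrr => /eqP; rewrite mulf_eq0 (gt_eqF e2) orbF mulf_eq0.
  rewrite (gt_eqF (odds_gt0 Q k0)) orbF subr_eq0 => /eqP QD.
  by move: r0; rewrite /rho QD subrr mul0r addr0 => /eqP; rewrite gt_eqF.
have kt0 : 0 < k * t by rewrite mulr_gt0 //; case/andP: t1 => /(lt_le_trans ltr01).
pose c (i : nat) := 1 + e * (i%:R / 14%:R).
have [[i]|/forallNP H] := pselect (exists i : 'I_14, generic (k * t) (l * c i)).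
  move=> gi; exists t, (c i); split=> //.
  rewrite lerDl mulr_ge0 ?divr_ge0 ?ler0n ?ltW //= ltrD2l.
  by rewrite -[ltRHS]mulr1 ltr_pM2l // ltr_pdivrMr ?ltr0n // mul1r ltr_nat.
have bad (i : 'I_14) : exists x,
    [/\ admissible D Q (k * t) x, logit (k * t) x = ln (l * c i) & hess (k * t) x = 0].
  apply: contrapT => /forallNP nx; apply: (H i); split=> // x Ax Lx.
  by apply/eqP => h0; apply: (nx x).
have [x xP] := choice bad.
have c0 (i : nat) : 0 < l * c i.
  by rewrite mulr_gt0 // ltr_pwDl // mulr_ge0 ?divr_ge0 ?ler0n ?ltW.
suff : (14 <= 13)%N by [].
rewrite -(size_enum_ord 14) -(size_map x).
apply: (@hess_zeros R D Q M (k * t)); rewrite ?gt_eqF //.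
  rewrite map_inj_uniq ?enum_uniq // => i j ij.
  have [_ Li _] := xP i; have [_ Lj _] := xP j.
  have : ln (l * c i) = ln (l * c j) by rewrite -Li -Lj ij.
  move=> /ln_inj; rewrite !posrE => /(_ (c0 i) (c0 j)).
  move=> /(mulfI (lt0r_neq0 l0)) /addrI /(mulfI (lt0r_neq0 e0)).
  have n14 : (14%:R : R)^-1 != 0 by rewrite invr_eq0 pnatr_eq0.
  by move=> /(mulIf n14) /eqP; rewrite eqr_nat => /eqP/val_inj.
by move=> _ /mapP[i _ ->]; have [] := xP i.
Qed.

End CriticalPairs.

(** * Local maxima of Gaussian mixtures *)

Section Dot.
Variables (R : realType) (d : nat).
Implicit Types u v x : 'rV[R]_d.

Definition dot u v : R := \sum_i u 0 i * v 0 i.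

Lemma dotC u v : dot u v = dot v u.
Proof. by apply: eq_bigr => i _; rewrite mulrC. Qed.

Lemma dotDl u1 u2 v : dot (u1 + u2) v = dot u1 v + dot u2 v.
Proof. by rewrite -big_split; apply: eq_bigr => i _; rewrite mxE mulrDl. Qed.

Lemma dotZl a u v : dot (a *: u) v = a * dot u v.
Proof. by rewrite mulr_sumr; apply: eq_bigr => i _; rewrite mxE mulrA. Qed.

Lemma dotNl u v : dot (- u) v = - dot u v.
Proof. by rewrite -scaleN1r dotZl mulN1r. Qed.

Lemma dotBl u1 u2 v : dot (u1 - u2) v = dot u1 v - dot u2 v.
Proof. by rewrite dotDl dotNl. Qed.

Lemma dotDr u v1 v2 : dot u (v1 + v2) = dot u v1 + dot u v2.
Proof. by rewrite !(dotC u) dotDl. Qed.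

Lemma dotZr a u v : dot u (a *: v) = a * dot u v.
Proof. by rewrite !(dotC u) dotZl. Qed.

Lemma dotBr u v1 v2 : dot u (v1 - v2) = dot u v1 - dot u v2.
Proof. by rewrite !(dotC u) dotBl. Qed.

Lemma dot_suml (I : finType) (F : I -> 'rV[R]_d) v :
  dot (\sum_i F i) v = \sum_i dot (F i) v.
Proof.
rewrite exchange_big /=; apply: eq_bigr => i _.
by rewrite summxE mulr_suml.
Qed.

Lemma dotvv_ge0 u : 0 <= dot u u.
Proof. by apply: sumr_ge0 => i _; rewrite -expr2 sqr_ge0. Qed.

Lemma dotvv_eq0 u : dot u u = 0 -> u = 0.
Proof.
move=> /eqP; rewrite psumr_eq0 => [/allP u0|i _]; last by rewrite -expr2 sqr_ge0.
apply/rowP => i; rewrite mxE; apply/eqP.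
by have := u0 i; rewrite mem_index_enum mulf_eq0 orbb => /(_ isT).
Qed.

Lemma norm2_sqr u : norm2 u ^+ 2 = dot u u.
Proof.
rewrite /norm2 sqr_sqrtr; first by apply: eq_bigr => i _; rewrite expr2.
by apply: sumr_ge0 => i _; exact: sqr_ge0.
Qed.

End Dot.

(** The second derivative of the difference is nonnegative by [expR_ge1Dx]; two applications of the
    mean value theorem bring this down to the function. *)
Lemma cosh_ge (R : realType) (x : R) : 2 + x ^+ 2 <= expR x + expR (- x).
Proof.
wlog x0 : x / 0 < x => [H|].
  have [x0|x0|<-] := ltrgtP 0 x; first exact: H.
    have := H (- x); rewrite oppr_gt0 opprK sqrrN [expR (- x) + _]addrC; exact.
  by rewrite expr0n oppr0 expR0 addr0.
have eN (y : R) : is_derive y 1 (fun z : R => expR (- z)) (- expR (- y)).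
  have := is_derive1_comp (is_derive_expR (- y)) (is_deriveNid y (1 : R)).
  by rewrite mulrN1.
have d1 (y : R) : is_derive y 1 (fun z : R => expR z - expR (- z) - 2 * z)
    (expR y + expR (- y) - 2).
  have := is_deriveB (is_deriveB (is_derive_expR y) (eN y))
    (is_deriveZ (2 : R) (is_derive_id y (1 : R))).
  by rewrite opprK /GRing.scale /= mulr1.
have d0 (y : R) : is_derive y 1 (fun z : R => expR z + expR (- z) - z ^+ 2)
    (expR y - expR (- y) - 2 * y).
  apply: (is_derive_eq (is_deriveB (is_deriveD (is_derive_expR y) (eN y))
    (is_deriveX 2 (is_derive_id y (1 : R))))).
  by rewrite /GRing.scale /= expr1 mulr1.
have g1 (y : R) : 0 < y -> 0 <= expR y - expR (- y) - 2 * y.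
  move=> y0; have [c _] := mvt_cc y0 (fun z _ => d1 z).
  rewrite !subr0 oppr0 subrr mulr0 !subr0 => ->; rewrite pmulr_lge0 // subr_ge0.
  have := lerD (expR_ge1Dx c) (expR_ge1Dx (- c)).
  by apply: le_trans; rewrite addrACA subrr addr0.
have [c /andP[c0 _]] := mvt_cc x0 (fun z _ => d0 z).
rewrite !subr0 oppr0 expR0 expr0n /= !subr0 => H.
have : 0 <= (expR c - expR (- c) - 2 * c) * x by rewrite mulr_ge0 ?g1 // ltW.
rewrite -H; lra.
Qed.

Lemma le0_of_small (R : realType) (c B e : R) : 0 < e ->
  (forall t, 0 < t < e -> c <= B * t) -> c <= 0.
Proof.
move=> e0 H; rewrite leNgt; apply/negP => c0.
have B0 : 0 < B.
  have /H : 0 < e / 2 < e by rewrite divr_gt0 //= ltr_pdivrMr // ltr_pMr // ltr1n.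
  by move=> /(lt_le_trans c0); rewrite pmulr_lgt0 // divr_gt0.
pose t := Num.min (e / 2) (c / B / 2).
have /H : 0 < t < e.
  rewrite lt_min !divr_gt0 //= gt_min; apply/orP; left.
  by rewrite ltr_pdivrMr // ltr_pMr // ltr1n.
apply/negP; rewrite -ltNge -ltr_pdivlMl // mulrC gt_min; apply/orP; right.
by rewrite ltr_pdivrMr // ltr_pMr ?divr_gt0 // ltr1n.
Qed.

(** The first- and second-order conditions on a line, obtained from inequalities: [1 + x <= expR x]
    for the linear term, and the sum of the values at [t] and [- t], bounded below by [cosh_ge], for
    the quadratic one. *)
Lemma gauss_line_max (R : realType) (n : nat) (G al : 'I_n -> R) (be : R) :
  0 <= be -> (forall j, 0 <= G j) ->
  (\forall t \near (0 : R), \sum_j G j * expR (al j * t - be * t ^+ 2) <= \sum_j G j) ->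
  \sum_j G j * al j = 0 /\ \sum_j G j * al j ^+ 2 <= 2 * be * \sum_j G j.
Proof.
move=> be0 G0 /nbhs_ballP[e /= e0 He].
have {}He t : `|t| < e -> \sum_j G j * expR (al j * t - be * t ^+ 2) <= \sum_j G j.
  by move=> te; apply: He; rewrite /ball /= sub0r normrN.
have lin t : `|t| < e -> t * \sum_j G j * al j <= be * t ^+ 2 * \sum_j G j.
  move=> /He; apply: contraTT; rewrite -!ltNge => lt.
  rewrite (@lt_le_trans _ _ (\sum_j (G j + (t * (G j * al j) - be * t ^+ 2 * G j)))) //.
    by rewrite big_split /= sumrB -!mulr_sumr ltrDl subr_gt0.
  apply: ler_sum => j _.
  have := ler_wpM2l (G0 j) (expR_ge1Dx (al j * t - be * t ^+ 2)).
  by apply: le_trans; rewrite le_eqVlt; apply/orP; left; apply/eqP; ring.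
have A0 : \sum_j G j * al j = 0.
  apply/eqP; rewrite eq_le; apply/andP; split; last rewrite -oppr_le0.
    apply: (@le0_of_small _ _ (be * \sum_j G j) e) => // t /andP[t0 te].
    rewrite -(ler_pM2l t0); apply: (le_trans (lin t _)); first by rewrite gtr0_norm.
    by rewrite le_eqVlt; apply/orP; left; apply/eqP; ring.
  apply: (@le0_of_small _ _ (be * \sum_j G j) e) => // t /andP[t0 te].
  rewrite -(ler_pM2l t0) mulrN -mulNr.
  apply: (le_trans (lin (- t) _)); first by rewrite normrN gtr0_norm.
  by rewrite le_eqVlt; apply/orP; left; apply/eqP; ring.
split=> //; rewrite -subr_le0.
(* The remainder is of order [t ^+ 2]; the bound [t < 1] makes it at most linear in [t]. *)
apply: (@le0_of_small _ _ (be * \sum_j G j * al j ^+ 2) (Num.min e 1)).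
  by rewrite lt_min e0 /=.
move=> t /andP[t0]; rewrite lt_min => /andP[te t1].
have := lerD (He t _) (He (- t) _); rewrite normrN gtr0_norm // => /(_ te te).
rewrite -big_split /= => le1.
have : \sum_j G j * (2 + (al j * t) ^+ 2 - be * t ^+ 2 * 2 - be * al j ^+ 2 * t ^+ 4)
    <= \sum_j G j + \sum_j G j.
  apply: le_trans le1; apply: ler_sum => j _.
  rewrite sqrrN mulrN -mulrDr ler_wpM2l // !expRD -mulrDl [leRHS]mulrC.
  have h1 := cosh_ge (al j * t).
  have h2 := expR_ge1Dx (- (be * t ^+ 2)).
  apply: le_trans (ler_wpM2l (expR_ge0 _) h1).
  apply: le_trans (ler_wpM2r _ h2); last by rewrite addr_ge0 ?sqr_ge0.
  by rewrite le_eqVlt; apply/orP; left; apply/eqP; ring.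
rewrite -subr_le0.
have -> : \sum_j G j * (2 + (al j * t) ^+ 2 - be * t ^+ 2 * 2 - be * al j ^+ 2 * t ^+ 4)
   - (\sum_j G j + \sum_j G j) =
   t ^+ 2 * (\sum_j G j * al j ^+ 2 - 2 * be * \sum_j G j - be * (\sum_j G j * al j ^+ 2) * t ^+ 2).
  rewrite !mulr_sumr !mulr_suml -!sumrB mulr_sumr -big_split /= -sumrB.
  by apply: eq_bigr => j _; ring.
rewrite pmulr_rle0 ?exprn_gt0 // subr_le0 => /le_trans; apply.
have S0 : 0 <= \sum_j G j * al j ^+ 2 by apply: sumr_ge0 => j _; rewrite mulr_ge0 ?sqr_ge0.
by rewrite ler_wpM2l ?mulr_ge0 // expr2 ler_piMl // ltW.
Qed.

Section Mixture.
Variables (R : realType) (d n : nat) (mu : 'I_n -> 'rV[R]_d).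
Implicit Types (w : 'I_n -> R) (x u : 'rV[R]_d).

Lemma gauss_density_gt0 x : 0 < gauss_density x.
Proof. by rewrite /gauss_density mulr_gt0 ?expR_gt0 // powR_gt0 // mulr_gt0 // pi_gt0. Qed.

Lemma gauss_densityD x u : gauss_density (x + u) =
  gauss_density x * expR (- dot x u - dot u u / 2).
Proof.
rewrite /gauss_density !norm2_sqr -mulrA -expRD; congr (_ * expR _).
by rewrite dotDl !dotDr (dotC u x); field.
Qed.

Lemma mode_conditions w x : (forall j, 0 <= w j) -> modes (gauss_mixture w mu) x ->
  let G j := w j * gauss_density (x - mu j) in
  \sum_j G j *: (mu j - x) = 0 /\
  forall u, \sum_j G j * dot (mu j - x) u ^+ 2 <= dot u u * \sum_j G j.
Proof.
move=> w0 xm G.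
have G0 j : 0 <= G j by rewrite mulr_ge0 // ltW // gauss_density_gt0.
have line u : \sum_j G j * dot (mu j - x) u = 0 /\
    \sum_j G j * dot (mu j - x) u ^+ 2 <= 2 * (dot u u / 2) * \sum_j G j.
  apply: gauss_line_max => //; first by rewrite divr_ge0 ?dotvv_ge0.
  have lineP : (fun t : R => x + t *: u) @ (0 : R) --> x.
    have c1 : (fun=> x) @ (0 : R) --> x by exact: cvg_cst.
    have := cvgD c1 (@scalel_continuous _ _ u (0 : R)).
    by rewrite scale0r addr0; apply.
  have : \forall t \near (0 : R),
    gauss_mixture w mu (x + t *: u) <= gauss_mixture w mu x by exact: lineP xm.
  apply: filterS => t.
  rewrite (_ : gauss_mixture w mu (x + t *: u) =
    \sum_j G j * expR (dot (mu j - x) u * t - dot u u / 2 * t ^+ 2)) //.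
  apply: eq_bigr => j _; rewrite addrAC gauss_densityD mulrA; congr (_ * expR _).
  by rewrite -(opprB x) dotNl !dotZr dotZl; field.
split=> [|u]; last by have [_] := line u; rewrite (mulrC 2) divfK.
(* The weighted sum is orthogonal to every direction, in particular to itself. *)
apply: dotvv_eq0; rewrite dot_suml.
have [V0 _] := line (\sum_j G j *: (mu j - x)); rewrite -[RHS]V0.
by apply: eq_bigr => j _; rewrite dotZl.
Qed.

End Mixture.

Section Mixture.
Variables (R : realType) (d n : nat) (mu : 'I_n -> 'rV[R]_d).
Implicit Types (w : 'I_n -> R) (x u : 'rV[R]_d).

(** The [p j] are the posterior weights at [x]; the last clause says that the posterior covariance
    of the means is at most the identity. *)
Lemma mode_barycenter w x : (forall j, 0 <= w j) -> (exists j, 0 < w j) ->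
  modes (gauss_mixture w mu) x ->
  exists p : 'I_n -> R, [/\ forall j, p j = w j * gauss_density (x - mu j) / gauss_mixture w mu x,
    \sum_j p j = 1, \sum_j p j *: mu j = x &
    forall u, \sum_j p j * dot (mu j - x) u ^+ 2 <= dot u u].
Proof.
move=> w0 [j0 wj0] /(mode_conditions w0)[V0 H].
have m0 : 0 < gauss_mixture w mu x.
  rewrite /gauss_mixture (bigD1 j0) //= ltr_pwDl //.
    exact: mulr_gt0 wj0 (gauss_density_gt0 _).
  by apply: sumr_ge0 => j _; rewrite mulr_ge0 // ltW // gauss_density_gt0.
exists (fun j => w j * gauss_density (x - mu j) / gauss_mixture w mu x).
have s1 : \sum_j w j * gauss_density (x - mu j) / gauss_mixture w mu x = 1.
  by rewrite -mulr_suml divff // gt_eqF.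
split=> //.
  apply/eqP; rewrite -subr_eq0 -[X in _ - X]scale1r -s1 scaler_suml -sumrB.
  rewrite (eq_bigr (fun j => (gauss_mixture w mu x)^-1 *:
     ((w j * gauss_density (x - mu j)) *: (mu j - x)))).
    by rewrite -scaler_sumr V0 scaler0.
  by move=> j _; rewrite -scalerBr scalerA mulrC.
move=> u; rewrite -(ler_pM2r m0); apply: le_trans (H u).
rewrite mulr_suml ler_sum // => j _.
by rewrite mulrAC mulfVK ?gt_eqF.
Qed.

(** Modes lie on the line. At [o + z *: v] the first-order condition is, up to a nonzero factor, an
    exponential polynomial in [z] with [n] linear coefficients, of total size at most [2 n]. Means
    of weight zero may lie off the line. *)
Lemma collinear_modes w (o v : 'rV[R]_d) (m : 'I_n -> R) (s : seq 'rV[R]_d) :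
  (forall j, 0 <= w j) -> (exists j, 0 < w j) ->
  (forall j, w j != 0 -> mu j = o + m j *: v) ->
  uniq s -> (forall x, x \in s -> modes (gauss_mixture w mu) x) ->
  (size s < n * 2)%N.
Proof.
move=> w0 w1 muE us sm.
pose N := dot v v.
pose c j := w j * expR (- (m j ^+ 2 * N / 2)).
have c0 j : 0 <= c j by rewrite mulr_ge0 ?expR_ge0.
pose sq := [seq (N * m j, (c j)%:P * ((m j)%:P - 'X)) | j <- enum 'I_n].
have sqE z : exppoly sq z = \sum_j c j * (m j - z) * expR (N * m j * z).
  rewrite /exppoly big_map big_enum /=; apply: eq_bigr => j _.
  by rewrite !hornerE.
have /choice[f fP] : forall x, exists z, x \in s -> x = o + z *: v /\ exppoly sq z = 0.
  move=> x; have [xs|] := boolP (x \in s); last by exists 0.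
  have [p [pE p1 px _]] := mode_barycenter w0 w1 (sm x xs).
  pose z := \sum_j p j * m j; exists z => _.
  have xE : x = o + z *: v.
    rewrite -px -(scale1r o) -p1 !scaler_suml -big_split; apply: eq_bigr => j _ /=.
    have [wj|wj] := eqVneq (w j) 0; first by rewrite pE wj !mul0r !scale0r addr0.
    by rewrite muE // scalerDr scalerA.
  split=> //; rewrite sqE.
  have mx0 : gauss_mixture w mu x != 0.
    by apply/eqP => m0; move: p1; rewrite big1 => [/esym/eqP|j _]; rewrite ?oner_eq0 // pE m0 invr0 mulr0.
  pose K := gauss_density (0 : 'rV[R]_d) / gauss_mixture w mu x * expR (- (z ^+ 2 * N / 2)).
  have K0 : K != 0.
    apply: mulf_neq0; last by rewrite gt_eqF ?expR_gt0.
    by apply: mulf_neq0; rewrite ?invr_eq0 // gt_eqF // gauss_density_gt0.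
  apply: (mulfI K0); rewrite mulr0.
  transitivity (\sum_j p j * (m j - z)); last first.
    under eq_bigr do rewrite mulrBr.
    by rewrite sumrB -mulr_suml p1 mul1r subrr.
  rewrite mulr_sumr; apply: eq_bigr => j _.
  have [wj|wj] := eqVneq (w j) 0; first by rewrite pE /c wj !mul0r mulr0.
  rewrite pE (_ : gauss_density (x - mu j) = gauss_density (0 : 'rV[R]_d) *
     (expR (- (z ^+ 2 * N / 2)) * expR (- (m j ^+ 2 * N / 2)) * expR (N * m j * z))).
    by rewrite /K /c; ring.
  rewrite -!expRD -[x - mu j]add0r gauss_densityD; congr (_ * expR _).
  rewrite (_ : x - mu j = (z - m j) *: v); last first.
    by rewrite xE muE // opprD addrACA subrr add0r scalerBl.
  rewrite !dotZr !dotZl -/N (_ : dot 0 v = 0); first by field.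
  by rewrite -(scale0r v) dotZl mul0r.
have uf : uniq (map f s).
  rewrite map_inj_in_uniq // => x y xs ys xy.
  by rewrite (fP x xs).1 (fP y ys).1 xy.
rewrite -(size_map f).
have : (size (map f s) < \sum_(q <- sq) size q.2)%N.
  apply: exppoly_zeros => //; last by move=> _ /mapP[x xs ->]; have [] := fP x xs.
  (* Beyond all the [m j] every summand is nonpositive, and one of positive weight is negative, so
     the sum is not identically zero. *)
  pose z := 1 + \sum_j `|m j|.
  have mz j : m j - z < 0.
    rewrite subr_lt0 /z (bigD1 j) //= addrCA ltr_pwDr //.
      by rewrite ltr_pwDl // sumr_ge0.
    exact: ler_norm.
  exists z; rewrite sqE; have [j wj] := w1.
  rewrite lt_eqF // (bigD1 j) //= ltr_nwDl //.
    by rewrite pmulr_llt0 ?expR_gt0 // pmulr_rlt0 // mulr_gt0 ?expR_gt0.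
  apply: sumr_le0 => i _; rewrite mulr_le0_ge0 ?expR_ge0 // mulr_ge0_le0 //.
  exact: ltW.
move=> /leq_trans; apply.
rewrite big_map big_enum /= -[X in (X * 2)%N]card_ord -sum_nat_const leq_sum // => j _.
have [->|cj] := eqVneq (c j) 0; first by rewrite mul0r size_poly0.
by rewrite size_Cmul // -opprB size_polyN size_XsubC.
Qed.

End Mixture.

(** * Persistence of modes under perturbation of the weights *)

Lemma continuous_sumr (R : realType) (T : topologicalType) (I : finType) (F : I -> T -> R) :
  (forall i, continuous (F i)) -> continuous (fun x => \sum_i F i x).
Proof.
move=> Fc; elim: (index_enum I) => [|i r IH] x.
  rewrite (_ : (fun x => _) = cst 0); first exact: cvg_cst.
  by apply: funext => y; rewrite big_nil.
rewrite (_ : (fun x => _) = (F i \+ fun x => \sum_(j <- r) F j x)).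
  by apply: cvgD; [exact: Fc|exact: IH].
by apply: funext => y; rewrite big_cons.
Qed.

Lemma seq_common_radius (R : realType) (T : eqType) (s : seq T) (P : T -> R -> Prop) :
  (forall x e e', 0 < e' -> e' <= e -> P x e -> P x e') ->
  (forall x, x \in s -> exists2 e, 0 < e & P x e) ->
  exists2 e, 0 < e & forall x, x \in s -> P x e.
Proof.
move=> mono; elim: s => [|x s IH] sP; first by exists 1.
have [e1 e10 Px] := sP x (mem_head _ _).
have [|e2 e20 Ps] := IH; first by move=> y ys; apply: sP; rewrite inE ys orbT.
have e0 : 0 < Num.min e1 e2 by rewrite lt_min e10.
exists (Num.min e1 e2) => // y; rewrite inE => /predU1P[->|/Ps Py].
  by apply: mono Px => //; rewrite ge_min lexx.
by apply: mono Py => //; rewrite ge_min lexx orbT.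
Qed.

Section Persistence.
Variables (R : realType) (d n : nat) (mu : 'I_n -> 'rV[R]_d).
Implicit Types (w : 'I_n -> R) (x u : 'rV[R]_d).

Lemma gauss_density_continuous : continuous (@gauss_density R d).
Proof.
have dc : continuous (fun x : 'rV[R]_d => dot x x).
  apply: continuous_sumr => i x.
  have xi := @coord_continuous R 1 d 0 i x; exact: (cvgM xi xi).
rewrite (_ : @gauss_density R d =
    fun x => (2 * pi) `^ (- (d%:R / 2)) * expR (- (dot x x / 2))); last first.
  by apply: funext => x; rewrite /gauss_density norm2_sqr.
move=> x; have dx : - (dot y y / 2) @[y --> x] --> - (dot x x / 2).
  exact: (cvgN (cvgMr_tmp (dc x))).
have ex := cvg_comp _ _ dx (@continuous_expR R _).
exact: (cvgMl_tmp ex).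
Qed.

Lemma gauss_mixture_continuous w : continuous (gauss_mixture w mu).
Proof.
apply: continuous_sumr => j x.
have xj : y - mu j @[y --> x] --> x - mu j.
  exact: (cvgB cvg_id (cvg_cst (mu j))).
have gx := cvg_comp _ _ xj (@gauss_density_continuous _).
exact: (cvgMl_tmp gx).
Qed.

Lemma seq_separated (s : seq 'rV[R]_d) x :
  exists2 r : R, 0 < r & forall y, y \in s -> `|y - x| < r -> y = x.
Proof.
elim: s => [|y s [r r0 IH]]; first by exists 1.
have [->|yx] := eqVneq y x.
  by exists r => // z; rewrite inE => /predU1P[->|zs] //; exact: IH.
exists (Num.min r `|y - x|); first by rewrite lt_min r0 normr_gt0 subr_eq0.
move=> z; rewrite inE lt_min => /predU1P[->|zs] /andP[zr]; last by move=> _; exact: IH.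
by rewrite ltxx.
Qed.

Lemma gauss_density_le x :
  gauss_density x <= (2 * pi) `^ (- (d%:R / 2)) :> R.
Proof.
rewrite /gauss_density ler_piMr ?powR_ge0 // -expR0 ler_expR oppr_le0.
by rewrite divr_ge0 ?sqr_ge0.
Qed.

Lemma gauss_mixture_close w w' (e : R) x : (forall j, `|w' j - w j| <= e) ->
  `|gauss_mixture w' mu x - gauss_mixture w mu x| <=
     n%:R * (e * (2 * pi) `^ (- (d%:R / 2))).
Proof.
move=> ww; rewrite /gauss_mixture -sumrB; apply: le_trans (ler_norm_sum _ _ _) _.
rewrite mulr_natl -[X in _ *+ X]card_ord -sumr_const ler_sum // => j _.
rewrite -mulrBl normrM ler_pM // gtr0_norm ?gauss_density_le //.
exact: gauss_density_gt0.
Qed.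

(** An isolated mode is a strict maximum over a small sphere, with a positive gap by compactness.
    For nearby weights the maximum over the closed ball is therefore attained inside it. *)
Lemma isolated_mode_persists w x (r : R) : (0 < d)%N -> 0 < r ->
  finite_set (modes (gauss_mixture w mu)) -> modes (gauss_mixture w mu) x ->
  exists2 e : R, 0 < e & forall w', (forall j, `|w' j - w j| <= e) ->
    exists2 x', modes (gauss_mixture w' mu) x' & `|x' - x| < r.
Proof.
move=> d0 r0 /finite_seqP[s sE] xm.
have [r1 r10 iso] := seq_separated s x.
have [r2 /= r20 max2] : exists2 r2 : R, 0 < r2 &
    forall y, `|y - x| < r2 -> gauss_mixture w mu y <= gauss_mixture w mu x.
  move/nbhs_ballP : (xm) => [r2 /= r20 H]; exists r2 => // y yx.
  by apply: H; rewrite -ball_normE /= distrC.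
pose q := Num.min r (Num.min r1 r2) / 2.
have q0 : 0 < q by rewrite divr_gt0 // !lt_min r0 r10.
have qlt : q < Num.min r (Num.min r1 r2).
  by rewrite ltr_pdivrMr // ltr_pMr ?ltr1n // !lt_min r0 r10.
move: qlt; rewrite !lt_min => /andP[qr /andP[qr1 qr2]].
(* A point of the sphere with the same value would itself be a mode, since a neighborhood of it
   stays within radius [r2]; this contradicts isolation. *)
have strict y : `|y - x| = q -> gauss_mixture w mu y < gauss_mixture w mu x.
  move=> yq; rewrite lt_neqAle max2 ?yq // andbT; apply/eqP => fE.
  have /iso : y \in s.
    have : modes (gauss_mixture w mu) y; last by rewrite sE.
    have : \forall z \near y, `|z - x| < r2.
      have : \forall z \near y, `|z - y| < r2 - q.
        by apply/nbhs_ballP; exists (r2 - q) => /=; rewrite ?subr_gt0 // => z;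
      rewrite -ball_normE /= distrC.
      apply: filterS => z zy; rewrite -(subrK y z) -addrA.
      by apply: le_lt_trans (ler_normD _ _) _; rewrite yq -ltrBrDr.
    by apply: filterS => z /max2; rewrite fE.
  by rewrite yq => /(_ qr1) yx; move: yq; rewrite yx subrr normr0 => q0'; rewrite -q0' ltxx in q0.
pose K := [set y : 'rV[R]_d | `|y - x| = q].
pose B := [set y : 'rV[R]_d | `|y - x| <= q].
have nc : continuous (fun y : 'rV[R]_d => `|y - x|).
  by move=> y; exact: (cvg_norm (cvgB cvg_id (cvg_cst x))).
have bB : bounded_set B.
  exists (`|x| + q); split; first exact: num_real.
  move=> M xM y By; apply: ltW; apply: le_lt_trans xM.
  by rewrite -(subrK x y) addrC; apply: le_trans (ler_normD _ _) _; rewrite lerD2l.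
have cB : compact B.
  apply: bounded_closed_compact => //.
  by apply: (@closed_comp _ _ (fun y : 'rV[R]_d => `|y - x|) [set z | z <= q]) => [y _|];
    [exact: nc|exact: closed_le].
have cK : compact K.
  apply: bounded_closed_compact.
    move: bB => [b [br bB]]; exists b; split=> // c /bB H y Ky; apply: H.
    by rewrite /B /= Ky.
  by apply: (@closed_comp _ _ (fun y : 'rV[R]_d => `|y - x|) [set z | z = q]) => [y _|];
    [exact: nc|exact: closed_eq].
have fc v : continuous (gauss_mixture v mu) by exact: gauss_mixture_continuous.
have [m mx mK] : exists2 m, m < gauss_mixture w mu x & forall y, K y -> gauss_mixture w mu y <= m.
  have [K0|K0] := pselect (K !=set0); last first.
    exists (gauss_mixture w mu x - 1); first by rewrite gtrBl.
    by move=> y Ky; exfalso; apply: K0; exists y.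
  have [|c Kc cmax] := EVT_max_rV K0 cK (f := gauss_mixture w mu).
    exact: continuous_subspaceT.
  exists (gauss_mixture w mu c); first by apply: strict; move: Kc; rewrite inE.
  by move=> y Ky; apply: cmax; rewrite inE.
pose C : R := n%:R * (2 * pi) `^ (- (d%:R / 2)).
have C0 : 0 <= C by rewrite mulr_ge0 ?powR_ge0.
(* Changing the weights by at most [e] moves the mixture by at most a third of the gap; the [+ 1]
   keeps the denominator nonzero. *)
pose e := (gauss_mixture w mu x - m) / (3 * (C + 1)).
have C1 : 0 < 3 * (C + 1) by rewrite mulr_gt0 // ltr_wpDl.
have e0 : 0 < e by rewrite divr_gt0 // subr_gt0.
exists e => // w' ww.
have close y : `|gauss_mixture w' mu y - gauss_mixture w mu y| <= (gauss_mixture w mu x - m) / 3.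
  apply: le_trans (gauss_mixture_close y ww) _.
  rewrite mulrCA -/C.
  have : e * (3 * (C + 1)) = gauss_mixture w mu x - m by rewrite divfK // gt_eqF.
  move: (gauss_mixture w mu x - m) (e) e0 => a b b0 abE; lra.
have [||c Bc cmax] := EVT_max_rV (A := B) (f := gauss_mixture w' mu) _ cB.
  by exists x; rewrite /B /= subrr normr0 ltW.
  exact: continuous_subspaceT.
have {}Bc : `|c - x| <= q by move: Bc; rewrite inE.
have cx : gauss_mixture w' mu x <= gauss_mixture w' mu c.
  by apply: cmax; rewrite inE /B /= subrr normr0 ltW.
have cq : `|c - x| < q.
  rewrite lt_neqAle Bc andbT; apply/eqP => cq.
  have h1 := mK c cq.
  have := close c; have := close x; rewrite !ler_norml => /andP[h2 _] /andP[_ h3].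
  have h4 : 0 < gauss_mixture w mu x - m by rewrite subr_gt0.
  lra.
exists c; last exact: lt_trans qr.
have : \forall z \near c, `|z - x| < q.
  have : \forall z \near c, `|z - c| < q - `|c - x|.
    by apply/nbhs_ballP; exists (q - `|c - x|) => /=; rewrite ?subr_gt0 // => z;
      rewrite -ball_normE /= distrC.
  apply: filterS => z zy; rewrite -(subrK c z) -addrA.
  by apply: le_lt_trans (ler_normD _ _) _; rewrite -ltrBrDr.
by apply: filterS => z zx; apply: cmax; rewrite inE /B /= ltW.
Qed.

(** Within [r / 2] of modes that are [r] apart, the perturbed modes remain distinct. *)
Lemma modes_persist w (s : seq 'rV[R]_d) : (0 < d)%N ->
  finite_set (modes (gauss_mixture w mu)) ->
  uniq s -> (forall x, x \in s -> modes (gauss_mixture w mu) x) ->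
  exists2 e : R, 0 < e & forall w', (forall j, `|w' j - w j| <= e) ->
    exists t, [/\ uniq t, size t = size s &
      forall x, x \in t -> modes (gauss_mixture w' mu) x].
Proof.
move=> d0 fin us sm.
have [r r0 sep] := @seq_common_radius R _ s
  (fun x r => forall y, y \in s -> `|y - x| < r -> y = x)
  (fun _ _ _ _ le H y ys yr => H y ys (lt_le_trans yr le))
  (fun x _ => seq_separated s x).
have r20 : 0 < r / 2 by rewrite divr_gt0.
have [||e e0 eP] := @seq_common_radius R _ s
  (fun x e => forall w', (forall j, `|w' j - w j| <= e) ->
    exists2 x', modes (gauss_mixture w' mu) x' & `|x' - x| < r / 2).
- by move=> x e e' _ le H w' ww; apply: H => j; exact: le_trans le.
- by move=> x xs; apply: isolated_mode_persists => //; exact: sm.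
exists e => // w' ww.
have /choice[f fP] : forall x, exists x', x \in s ->
    modes (gauss_mixture w' mu) x' /\ `|x' - x| < r / 2.
  move=> x; have [xs|] := boolP (x \in s); last by exists 0.
  by have [x' ? ?] := eP x xs w' ww; exists x'.
exists (map f s); split; last 2 first.
- by rewrite size_map.
- by move=> _ /mapP[x xs ->]; have [] := fP x xs.
rewrite map_inj_in_uniq // => x y xs ys xy; apply: sep => //.
have [_ fx] := fP x xs; have [_ fy] := fP y ys.
rewrite -(subrK (f x) x) -addrA (splitr r) (le_lt_trans (ler_normD _ _)) // ltrD //.
  by rewrite distrC.
by rewrite xy.
Qed.

End Persistence.

(** * Three components *)

(** The vectors [(- B, A)] and [(C, - B)] give [A] and [C] times the determinant; if [A = C = 0],
    then [(1, 1)] and [(1, -1)] force [B = 0]. *)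
Lemma psd2_det (R : realFieldType) (A B C : R) :
  (forall a b, 0 <= A * a ^+ 2 + 2 * B * (a * b) + C * b ^+ 2) -> 0 <= A * C - B ^+ 2.
Proof.
move=> H.
have A0 : 0 <= A by have := H 1 0; rewrite !expr2 !mulr0 !addr0 !mulr1.
have C0 : 0 <= C by have := H 0 1; rewrite !expr2 !mul0r !mulr0 !add0r !mulr1.
have hA : 0 <= A * (A * C - B ^+ 2).
  by apply: le_trans (H (- B) A) _; rewrite le_eqVlt; apply/orP; left; apply/eqP; ring.
have hC : 0 <= C * (A * C - B ^+ 2).
  by apply: le_trans (H C (- B)) _; rewrite le_eqVlt; apply/orP; left; apply/eqP; ring.
have [A1|A1] := ltrP 0 A; first by rewrite pmulr_rge0 in hA.
have [C1|C1] := ltrP 0 C; first by rewrite pmulr_rge0 in hC.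
have A_0 : A = 0 by apply/le_anti; rewrite A1.
have C_0 : C = 0 by apply/le_anti; rewrite C1.
have h1 := H 1 1; have h2 := H 1 (-1).
have -> : B = 0 by move: h1 h2; rewrite A_0 C_0 !expr2; lra.
by rewrite A_0 mul0r expr0n subrr.
Qed.

(** [h] is the component of [g] orthogonal to [v], so the Gram determinant vanishes only if [g] is a
    multiple of [v]. *)
Lemma gram_residual (R : realType) (d : nat) (v g : 'rV[R]_d) : dot v v != 0 ->
  let h := g - (dot v g / dot v v) *: v in
  dot h h * dot v v = dot v v * dot g g - dot v g ^+ 2.
Proof.
move=> v0 /=; rewrite !dotBr !dotBl !dotZr !dotZl (dotC g v).
by field.
Qed.

Section Triangle.
Variables (R : realType) (d : nat) (mu : 'I_3 -> 'rV[R]_d).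

(** The indices have the shape that [big_ord_recl] produces. *)
Let i0 : 'I_3 := ord0.
Let i1 : 'I_3 := lift ord0 ord0.
Let i2 : 'I_3 := lift ord0 (lift ord0 ord0).

Lemma ord3P (j : 'I_3) : [\/ j = i0, j = i1 | j = i2].
Proof.
by case: j => -[|[|[|//]]] lt3; [apply: Or31|apply: Or32|apply: Or33]; exact: val_inj.
Qed.

Lemma sum3 (V : zmodType) (F : 'I_3 -> V) : \sum_j F j = F i0 + F i1 + F i2.
Proof. by rewrite !big_ord_recl big_ord0 addr0 addrA. Qed.

Let v := mu i1 - mu i0.
Let g := mu i2 - mu i0.
Let D := dot v v.
Let Q := dot v g.
Let M := dot g g.

(* The factor c in a_i / a_0 = c * exp <x - mu_0, mu_i - mu_0>, with a_i the posterior weights *)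
Definition ratio_const (w : 'I_3 -> R) (i : 'I_3) :=
  w i / w i0 * expR (- (dot (mu i - mu i0) (mu i - mu i0) / 2)).

Hypotheses (D0 : 0 < D) (Dl0 : 0 < D * M - Q ^+ 2).

Lemma mode_critical w x : (forall j, 0 < w j) -> modes (gauss_mixture w mu) x ->
  exists p : R * R, [/\ x = mu i0 + p.1 *: v + p.2 *: g,
    critical D Q M (ratio_const w i1) (ratio_const w i2) p.1 p.2 & 0 <= hess_det D Q M p.1 p.2].
Proof.
move=> w0 xm.
have [|p [pE p1 px pH]] := mode_barycenter (fun j => ltW (w0 j)) _ xm.
  by exists i0.
have m0 : 0 < gauss_mixture w mu x.
  rewrite /gauss_mixture sum3.
  have gj j : 0 < w j * gauss_density (x - mu j) by exact: mulr_gt0 (w0 j) (gauss_density_gt0 _).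
  by rewrite addr_gt0 // addr_gt0.
have pj j : 0 < p j.
  by rewrite pE; apply: divr_gt0 => //; exact: mulr_gt0 (w0 j) (gauss_density_gt0 _).
move: p1 px; rewrite !sum3 => p1 px.
have p0 : 1 - p i1 - p i2 = p i0 by rewrite -p1; ring.
have xE : x = mu i0 + p i1 *: v + p i2 *: g.
  by apply/rowP => i; rewrite -px -p0 /v /g !mxE; ring.
have ratio i : p i = p i0 * (ratio_const w i * expR (dot (x - mu i0) (mu i - mu i0))).
  rewrite !pE /ratio_const.
  have -> : x - mu i = (x - mu i0) + - (mu i - mu i0) by rewrite opprB addrA subrK.
  rewrite gauss_densityD.
  have -> : - dot (x - mu i0) (- (mu i - mu i0)) - dot (- (mu i - mu i0)) (- (mu i - mu i0)) / 2
     = dot (x - mu i0) (mu i - mu i0) - dot (mu i - mu i0) (mu i - mu i0) / 2.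
    by rewrite dotNl !(dotC _ (- _)) !dotNl (dotC _ (x - _)); ring.
  rewrite expRD; field.
  by rewrite !gt_eqF.
have yE : x - mu i0 = p i1 *: v + p i2 *: g by rewrite xE; apply/rowP => i; rewrite !mxE; ring.
exists (p i1, p i2); split=> //=.
  split=> //.
  - by rewrite -subr_gt0 opprD addrA p0.
  - by rewrite p0 {1}ratio yE dotDl !dotZl -/v (dotC g) -/D -/Q (mulrC D) (mulrC Q).
  - by rewrite p0 {1}ratio yE dotDl !dotZl -/g -/M -/Q (mulrC M) (mulrC Q).
(* The covariance bound tested on [a *: v + b *: g]. The matrix of this form is [G - G Cov G], with
   determinant [det G * det (I - Cov G)], and [det G] is positive. *)
have H a b : 0 <= (D - (p i1 * D ^+ 2 + p i2 * Q ^+ 2 - (p i1 * D + p i2 * Q) ^+ 2)) * a ^+ 2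
   + 2 * (Q - (p i1 * (D * Q) + p i2 * (Q * M)
             - (p i1 * D + p i2 * Q) * (p i1 * Q + p i2 * M))) * (a * b)
   + (M - (p i1 * Q ^+ 2 + p i2 * M ^+ 2 - (p i1 * Q + p i2 * M) ^+ 2)) * b ^+ 2.
  have := pH (a *: v + b *: g); rewrite -subr_ge0 sum3 => /le_trans; apply.
  rewrite le_eqVlt; apply/orP; left; apply/eqP.
  have dx i z : dot (mu i - x) z = dot (mu i - mu i0) z - (p i1 * dot v z + p i2 * dot g z).
    have -> : mu i - x = (mu i - mu i0) - (x - mu i0) by rewrite opprB addrA subrK.
    by rewrite (dotBl (mu i - mu i0)) yE (dotDl (p i1 *: v)) !dotZl.
  rewrite !dx subrr -p0.
  have -> (z : 'rV[R]_d) : dot 0 z = 0 by rewrite -(scale0r z) dotZl mul0r.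
  rewrite -/v -/g !(dotDr _ (a *: v)) !dotZr !(dotDl (a *: v)) !dotZl.
  rewrite (dotC g v) -/D -/Q -/M.
  ring.
rewrite -(pmulr_rge0 _ Dl0) /hess_det; apply: le_trans (psd2_det H) _.
by rewrite le_eqVlt; apply/orP; left; apply/eqP; ring.
Qed.

Lemma noncollinear_modes w : (0 < d)%N -> (forall j, 0 < w j) ->
  finite_set (modes (gauss_mixture w mu)) /\
  forall s : seq 'rV[R]_d, uniq s ->
    (forall x, x \in s -> modes (gauss_mixture w mu) x) -> (size s <= 8)%N.
Proof.
move=> d0 w0.
have odds0 w' i : (forall j, 0 < w' j) -> 0 < ratio_const w' i.
  by move=> w'0; rewrite mulr_gt0 ?expR_gt0 // divr_gt0.
have pairs w' s : (forall j, 0 < w' j) -> uniq s ->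
    (forall x, x \in s -> modes (gauss_mixture w' mu) x) ->
    exists t : seq (R * R), [/\ uniq t, size t = size s & forall p, p \in t ->
      critical D Q M (ratio_const w' i1) (ratio_const w' i2) p.1 p.2 /\
      0 <= hess_det D Q M p.1 p.2].
  move=> w'0 us sm.
  have /choice[f fP] : forall x, exists p : R * R, x \in s ->
      [/\ x = mu i0 + p.1 *: v + p.2 *: g,
        critical D Q M (ratio_const w' i1) (ratio_const w' i2) p.1 p.2 &
        0 <= hess_det D Q M p.1 p.2].
    move=> x; have [xs|] := boolP (x \in s); last by exists (0, 0).
    by have [p pP] := mode_critical w'0 (sm x xs); exists p.
  exists (map f s); split; last 2 first.
  - by rewrite size_map.
  - by move=> _ /mapP[x xs ->]; have [] := fP x xs.
  rewrite map_inj_in_uniq // => x y xs ys xy.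
  by have [-> _ _] := fP x xs; have [-> _ _] := fP y ys; rewrite xy.
(* Finiteness comes first, since persistence under perturbation relies on isolated modes. *)
have fin : finite_set (modes (gauss_mixture w mu)).
  apply: contrapT => /(infinite_set_fset 19)[B Bm B19].
  have [//||t [ut tB tP]] := pairs w (enum_fset B) w0; first exact: fset_uniq.
    by move=> x xB; apply: Bm.
  have : (size t <= 18)%N.
    apply: (count_critical_pairs D0 Dl0 (odds0 w i1 w0) (odds0 w i2 w0) ut).
    by move=> p /tP[].
  by rewrite tB leqNgt B19.
split=> // s us sm.
have [e e0 persist] := modes_persist d0 fin us sm.
(* Scaling weights 1 and 2 by [t1] and [t2] scales the two ratio constants alike. Factors below
   [1 + e / W] change each weight by at most [e]. *)
pose W := w i1 + w i2.
have W0 : 0 < W by rewrite addr_gt0.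
have [t1 [t2 [/andP[t1l t1u] /andP[t2l t2u] gen]]] :=
  generic_dense D0 Dl0 (odds0 w i1 w0) (odds0 w i2 w0) (divr_gt0 e0 W0).
pose w' j := if j == i1 then w i1 * t1 else if j == i2 then w i2 * t2 else w j.
have t10 : 0 < t1 by exact: lt_le_trans t1l.
have t20 : 0 < t2 by exact: lt_le_trans t2l.
have w'0 j : 0 < w' j by rewrite /w'; case: ifP => _; [|case: ifP => _]; rewrite ?mulr_gt0.
have close i t : w i <= W -> 1 <= t -> t < 1 + e / W -> `|w i * t - w i| <= e.
  move=> iW tl tu; rewrite -[X in _ - X]mulr1 -mulrBr ger0_norm; last first.
    by rewrite mulr_ge0 ?subr_ge0 // ltW.
  rewrite -ltrBlDl in tu.
  rewrite (le_trans (ler_wpM2l (ltW (w0 i)) (ltW tu))) // mulrA ler_pdivrMr // mulrC.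
  by rewrite ler_pM2l.
have [j|t [ut st tm]] := persist w'.
  rewrite /w'; case: eqP => [->|_]; first by apply: close => //; rewrite lerDl ltW.
  case: eqP => [->|_]; first by apply: close => //; rewrite lerDr ltW.
  by rewrite subrr normr0 ltW.
have [q [uq sq qP]] := pairs w' t w'0 ut tm.
rewrite -st -sq.
have o1 : ratio_const w' i1 = ratio_const w i1 * t1.
  by rewrite /ratio_const /w' /=; ring.
have o2 : ratio_const w' i2 = ratio_const w i2 * t2.
  by rewrite /ratio_const /w' /=; ring.
apply: (count_generic_modes D0 Dl0 (odds0 w' i1 w'0) (odds0 w' i2 w'0)) => //.
by rewrite o1 o2.
Qed.

End Triangle.

Lemma noncollinear_gram_gt0 (R : realType) (d : nat) (mu : 'I_3 -> 'rV[R]_d) (w : 'I_3 -> R) :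
  (forall j, 0 <= w j) ->
  (forall (o v : 'rV[R]_d) (m : 'I_3 -> R),
     ~ (forall j, w j != 0 -> mu j = o + m j *: v)) ->
  [/\ forall j, 0 < w j,
    0 < dot (mu (lift ord0 ord0) - mu ord0) (mu (lift ord0 ord0) - mu ord0) &
    0 < dot (mu (lift ord0 ord0) - mu ord0) (mu (lift ord0 ord0) - mu ord0)
      * dot (mu (lift ord0 (lift ord0 ord0)) - mu ord0) (mu (lift ord0 (lift ord0 ord0)) - mu ord0)
      - dot (mu (lift ord0 ord0) - mu ord0) (mu (lift ord0 (lift ord0 ord0)) - mu ord0) ^+ 2].
Proof.
move=> w0 nc.
set i0 : 'I_3 := ord0; set i1 : 'I_3 := lift ord0 ord0.
set i2 : 'I_3 := lift ord0 (lift ord0 ord0).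
set v := mu i1 - mu i0; set g := mu i2 - mu i0.
(* If one weight vanishes, the two remaining means lie on a line. *)
have wp i j k : (forall l, [\/ l = i, l = j | l = k]) -> j != k -> 0 < w i.
  move=> ijk jk; rewrite lt0r w0 andbT; apply/eqP => wi.
  apply: (nc (mu j) (mu k - mu j) (fun l => (l == k)%:R)) => l.
  case: (ijk l) => ->; first by rewrite wi eqxx.
    by rewrite (negPf jk) scale0r addr0.
  by rewrite eqxx scale1r addrC subrK.
have v0 : 0 < dot v v.
  rewrite lt0r dotvv_ge0 andbT; apply/eqP => /dotvv_eq0/eqP; rewrite subr_eq0 => /eqP v0.
  apply: (nc (mu i0) g (fun l => (l == i2)%:R)) => l _.
  case: (ord3P l) => ->; rewrite ?eqxx ?scale1r ?scale0r ?addr0 //.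
  by rewrite /g addrC subrK.
split=> //.
  move=> j; case: (ord3P j) => ->.
  - by apply: (wp i0 i1 i2 (@ord3P)).
  - by apply: (wp i1 i0 i2) => // l; case: (ord3P l) => ->; [apply: Or32|apply: Or31|apply: Or33].
  - by apply: (wp i2 i0 i1) => // l; case: (ord3P l) => ->; [apply: Or32|apply: Or33|apply: Or31].
pose h := g - (dot v g / dot v v) *: v.
have hE := gram_residual g (lt0r_neq0 v0).
rewrite -hE mulr_gt0 // lt0r dotvv_ge0 andbT.
apply/eqP => /dotvv_eq0/eqP; rewrite subr_eq0 => /eqP gE.
apply: (nc (mu i0) v (fun l => if l == i2 then dot v g / dot v v else (l == i1)%:R)) => l _.
case: (ord3P l) => -> /=; rewrite ?scale0r ?addr0 ?scale1r //.
  by rewrite /v addrC subrK.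
by rewrite -gE /g addrC subrK.
Qed.

Theorem theorem2 (R : realType) (d : nat) (hd : (1 <= d)%N)
    (mu : 'I_3 -> 'rV[R]_d) (w : 'I_3 -> R)
    (hw0 : forall j, 0 <= w j) (hw1 : \sum_(j < 3) w j = 1) :
  finite_set (modes (gauss_mixture w mu)) /\
  (#|` fset_set (modes (gauss_mixture w mu)) | <= 8)%N.
Proof.
(* Finiteness is proved separately because [fset_set] of an infinite set is empty by convention. *)
suff [fin H] : finite_set (modes (gauss_mixture w mu)) /\
    forall s : seq 'rV[R]_d, uniq s ->
    (forall x, x \in s -> modes (gauss_mixture w mu) x) -> (size s <= 8)%N.
  split=> //; apply: H; first exact: fset_uniq.
  by move=> x; rewrite in_fset_set // inE.
have w1 : exists j, 0 < w j.
  apply: contrapT => /forallNP H; move: hw1; rewrite big1 => [/esym/eqP|j _].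
    by rewrite oner_eq0.
  by apply/le_anti; rewrite hw0 leNgt andbT; apply/negP; exact: H.
have [[c [v [m muE]]]|nc] := pselect (exists o v m,
    forall j, w j != 0 -> mu j = o + m j *: v).
  have count s : uniq s -> (forall x, x \in s -> modes (gauss_mixture w mu) x) ->
    (size s <= 5)%N by exact: (collinear_modes hw0 w1 muE).
  split; last by move=> s us sm; apply: leq_trans (count s us sm) _.
  apply: contrapT => /(infinite_set_fset 6)[B Bm]; rewrite leqNgt => /negP; apply.
  by rewrite ltnS; apply: count; [exact: fset_uniq|move=> x xB; exact: Bm].
have [|wp D0 Dl0] := @noncollinear_gram_gt0 R d mu w hw0.
  by move=> o v m muE; apply: nc; exists o, v, m.
exact: noncollinear_modes.
Qed.
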